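(* Let $K=\mathbb{Q}(i)$, $\mathcal{O}=\mathbb{Z}[i]$, $\ell$ a prime unramified in $K$ and $R=\overline{\mathbb{F}}_\ell$. Let $\Gamma$ be a congruence subgroup of $\mathrm{GL}_2(\mathcal{O})$ and $V$ a Serre weight (as defined below) with its left $\mathrm{GL}_2(\mathcal{O})$-action. Let $N=(R[\mathrm{GL}_2(\mathcal{O})]\otimes_R V)_\Gamma$ be the module of $\Gamma$-coinvariants, where $\Gamma$ acts diagonally on the left, and with the right $R[\mathrm{GL}_2(\mathcal{O})]$-action $(h\otimes v)g=hg\otimes v$. With \[ J=\begin{pmatrix} i&0\\0&1\end{pmatrix},\quad S=\begin{pmatrix}0&i\\1&0\end{pmatrix},\quad L=\begin{pmatrix}1&-1\\1&0\end{pmatrix}, \] the sequence of $R$-modules \[ 0\to N(I-J)+N(I+S)+N(I+L+L^2)\to N\to H_0(\Gamma,St\otimes V)\to 0 \] is exact, where the first map is inclusion and the second is induced by $h\otimes v\mapsto [h(0),h(\infty)]\otimes v$.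
   Context: A column $v=\binom{a}{b}\in\mathcal{O}^2$ is unimodular if $\gcd(a,b)=1$. The Steinberg module $St$ is the quotient of the free $R$-module on symbols $[v_1,v_2]$ ($v_i$ unimodular columns) by the submodule generated by $[v_2,v_1]+[v_1,v_2]$; $[v_1,v_2]$ whenever $\det(v_1\,v_2)=0$; and $[v_1,v_3]-[v_1,v_2]-[v_2,v_3]$. $\mathrm{GL}_2(\mathcal{O})$ acts on $St$ by $g[v_1,v_2]=[gv_1,gv_2]$, and $\Gamma$ acts diagonally on $St\otimes_R V$; $H_0$ denotes coinvariants. For $h\in\mathrm{GL}_2(\mathcal{O})$, $h(0)=h\binom01$, $h(\infty)=h\binom10$. A Serre weight is an irreducible $R$-representation of $\mathrm{GL}_2(\mathcal{O}/\ell\mathcal{O})\cong\prod_{\mathfrak p\mid\ell}\mathrm{GL}_2(\mathcal{O}/\mathfrak p)$, explicitly $V=\bigotimes_{\mathfrak p\mid\ell}V_{\mathfrak p}$ with $V_{\mathfrak p}=\bigotimes_{\tau}(\det^{a_\tau}\otimes\mathrm{Sym}^{b_\tau-1}k_{\mathfrak p}^2)\otimes_\tau\overline{\mathbb{F}}_\ell$, $\tau$ ranging over embeddings $k_{\mathfrak p}=\mathcal{O}/\mathfrak p\hookrightarrow\overline{\mathbb{F}}_\ell$; $\mathrm{Sym}^{n}k_{\mathfrak p}^2$ is the space of homogeneous degree-$n$ polynomials in $X,Y$, on which $g\in\mathrm{GL}_2(\mathcal{O})$ acts through its reduction $\bar g=\begin{pmatrix}a&b\\c&d\end{pmatrix}$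 by $P(X,Y)\mapsto P(dX-bY,-cX+aY)$. *)

(* Defs.v *)
From HB Require Import structures.
From mathcomp Require Import all_boot all_algebra.
From mathcomp Require Import boolp.
From mathcomp Require Import ring.
From mathcomp Require Import freeg mpoly.

Set Implicit Arguments.
Unset Strict Implicit.
Unset Printing Implicit Defensive.

Import GRing.Theory.

Local Open Scope ring_scope.
Local Open Scope quotient_scope.

Section Span.
Variables (R : nzRingType) (V : lmodType R) (S : V -> Prop).

Definition lspan : {pred V} :=
  [pred v | `[< exists s : seq (R * V),
      (forall x, x \in s -> S x.2) /\ v = \sum_(x <- s) x.1 *: x.2 >]].

Lemma lspan_submod_closed : submod_closed lspan.
Proof.
split=> [|a u v /asboolP[s [Ss ->]] /asboolP[t [St ->]]].
  by apply/asboolP; exists [::]; split=> //; rewrite big_nil.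
apply/asboolP; exists ([seq (a * x.1, x.2) | x <- s] ++ t); split.
  by move=> x; rewrite mem_cat => /orP[/mapP[y /Ss Sy ->]|/St].
rewrite big_cat big_map scaler_sumr; congr (_ + _).
by apply: eq_bigr => x _; rewrite scalerA.
Qed.
HB.instance Definition _ :=
  GRing.isSubmodClosed.Build R V lspan lspan_submod_closed.

Lemma mem_lspan v : S v -> v \in lspan.
Proof.
move=> Sv; apply/asboolP; exists [:: (1, v)]; split.
  by move=> x; rewrite inE => /eqP->.
by rewrite big_seq1 scale1r.
Qed.

Lemma lspan0 (U : lmodType R) (f : {linear V -> U}) :
  (forall v, S v -> f v = 0) -> forall v, v \in lspan -> f v = 0.
Proof.
move=> fS v /asboolP[s [Ss ->]]; rewrite linear_sum big_seq big1 // => x xs.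
by rewrite linearZ /= fS ?scaler0 //; apply: Ss.
Qed.

(* A record, so that lquot is a rigid head for unification. *)
Record lquot := LQuot { lquot_val : {ideal_quot lspan} }.
HB.instance Definition _ := [isNew for lquot_val].
HB.instance Definition _ := [Choice of lquot by <:].

Definition lpi (v : V) : lquot := LQuot (\pi v).
Definition lrepr (q : lquot) : V := repr (lquot_val q).

Lemma lreprK (q : lquot) : lpi (lrepr q) = q.
Proof. by case: q => q; rewrite /lpi /lrepr reprK. Qed.

Lemma lpi_eq u v : u - v \in lspan -> lpi u = lpi v.
Proof.
by move=> uv; congr LQuot; apply/eqP; rewrite -[_ == _]Quotient.idealrBE.
Qed.

Lemma lrepr_lpi v : lrepr (lpi v) - v \in lspan.
Proof. by rewrite Quotient.idealrBE reprK. Qed.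

Definition lquot_add (p q : lquot) := LQuot (lquot_val p + lquot_val q).
Definition lquot_opp (p : lquot) := LQuot (- lquot_val p).
Lemma lquot_addA : associative lquot_add.
Proof. by move=> p q r; congr LQuot; rewrite /= addrA. Qed.
Lemma lquot_addC : commutative lquot_add.
Proof. by move=> p q; congr LQuot; rewrite /= addrC. Qed.
Lemma lquot_add0 : left_id (LQuot 0) lquot_add.
Proof. by case=> q; congr LQuot; rewrite /= add0r. Qed.
Lemma lquot_addN : left_inverse (LQuot 0) lquot_opp lquot_add.
Proof. by case=> q; congr LQuot; rewrite /= addNr. Qed.
HB.instance Definition _ := GRing.isZmodule.Build lquot
  lquot_addA lquot_addC lquot_add0 lquot_addN.

Lemma lpi_zmod_morphism : zmod_morphism lpi.
Proof. by move=> u v; congr LQuot; rewrite pi_is_zmod_morphism. Qed.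
HB.instance Definition _ := GRing.isZmodMorphism.Build V lquot lpi
  lpi_zmod_morphism.

Definition lquot_scale (a : R) (q : lquot) : lquot := lpi (a *: lrepr q).

Lemma lpiZ a v : lquot_scale a (lpi v) = lpi (a *: v).
Proof. by apply: lpi_eq; rewrite -scalerBr rpredZ // lrepr_lpi. Qed.

Lemma lquotP (P : lquot -> Prop) : (forall v, P (lpi v)) -> forall q, P q.
Proof. by move=> Pv q; rewrite -[q]lreprK. Qed.

Lemma lquot_scaleA a b q :
  lquot_scale a (lquot_scale b q) = lquot_scale (a * b) q.
Proof. by elim/lquotP: q => v; rewrite !lpiZ scalerA. Qed.
Lemma lquot_scale1 : left_id 1 lquot_scale.
Proof. by elim/lquotP => v; rewrite lpiZ scale1r. Qed.
Lemma lquot_scaleDr : right_distributive lquot_scale +%R.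
Proof.
move=> a; elim/lquotP => u; elim/lquotP => v.
by rewrite -raddfD !lpiZ scalerDr raddfD.
Qed.
Lemma lquot_scaleDl q : {morph lquot_scale^~ q : a b / a + b}.
Proof. by move=> a b; elim/lquotP: q => v; rewrite !lpiZ scalerDl raddfD. Qed.
HB.instance Definition _ := GRing.Zmodule_isLmodule.Build R lquot
  lquot_scaleA lquot_scale1 lquot_scaleDr lquot_scaleDl.

Lemma lpi_scalable : scalable lpi.
Proof. by move=> a v; rewrite -lpiZ. Qed.
HB.instance Definition _ := GRing.isScalable.Build R V lquot _ lpi lpi_scalable.

End Span.

Section Descend.
Variables (R : nzRingType) (V U : lmodType R) (S : V -> Prop).
Variables (f : {linear V -> U}) (fS : forall v, S v -> f v = 0).

Definition descend of (forall v, S v -> f v = 0) :=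
  fun q : lquot S => f (lrepr q).

Lemma descendE v : descend fS (lpi S v) = f v.
Proof.
by apply/eqP; rewrite -subr_eq0 -raddfB; apply/eqP/(lspan0 fS)/lrepr_lpi.
Qed.

Lemma descend_is_linear : linear (descend fS).
Proof.
move=> a; elim/lquotP=> u; elim/lquotP=> v.
by rewrite -linearP !descendE linearP.
Qed.
HB.instance Definition _ := GRing.isLinear.Build R (lquot S) U _
  (descend fS) descend_is_linear.

End Descend.

Section Free.
Variables (R : nzRingType) (K : choiceType).

Lemma freeg_lin_ind (P : {freeg K / R} -> Prop) :
  P 0 -> (forall a k x, P x -> P (a *: << k >> + x)) -> forall x, P x.
Proof.
move=> P0 PS; apply: freeg_ind_dom0 => // a k x _ _ Px.
suff -> : << a *g k >> = a *: << k >> :> {freeg K / R} by apply: PS.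
apply/eqP/freeg_eqP => j; rewrite coeffZ !coeffU mul1r //.
Qed.

Variables (V : lmodType R) (f : K -> V).

Lemma fglift_is_zmod_morphism : zmod_morphism (fglift f).
Proof. exact: lift_is_additive. Qed.
HB.instance Definition _ :=
  GRing.isZmodMorphism.Build _ _ (fglift f) fglift_is_zmod_morphism.

Lemma extendE k : fglift f << k >> = f k.
Proof. by rewrite liftU scale1r. Qed.

Lemma fglift_scalable : scalable (fglift f).
Proof.
move=> a x; elim/freeg_lin_ind: x => [|b k x IHx].
  by rewrite scaler0 !raddf0.
have fgl c : fglift f (c *: << k >>) = c *: f k.
  suff -> : c *: << k >> = << c *g k >> :> {freeg K / R} by rewrite liftU.
  by apply/eqP/freeg_eqP => j; rewrite coeffZ !coeffU mul1r.
by rewrite scalerDr !raddfD /= IHx !scalerA !fgl scalerA.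
Qed.
HB.instance Definition _ :=
  GRing.isScalable.Build R _ _ _ (fglift f) fglift_scalable.

End Free.

Lemma free_ext (R : nzRingType) (K : choiceType) (V : lmodType R)
    (f g : {linear {freeg K / R} -> V}) :
  (forall k, f << k >> = g << k >>) -> f =1 g.
Proof.
move=> fg; elim/freeg_lin_ind => [|a k x fgx]; first by rewrite !raddf0.
by rewrite !linearP fg fgx.
Qed.

Lemma lquot_free_ext (R : nzRingType) (K : choiceType) (V : lmodType R)
    (S : {freeg K / R} -> Prop) (f g : {linear lquot S -> V}) :
  (forall k, f (lpi S << k >>) = g (lpi S << k >>)) -> f =1 g.
Proof.
move=> fg; elim/lquotP => x.
exact: (@free_ext _ _ _ (f \o lpi S) (g \o lpi S)).
Qed.

Section Tensor.
Variables (R : comNzRingType) (A B : lmodType R).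

Inductive tens_rel : {freeg (A * B)%type / R} -> Prop :=
| TensDl a a' b : tens_rel (<< (a + a', b) >> - << (a, b) >> - << (a', b) >>)
| TensDr a b b' : tens_rel (<< (a, b + b') >> - << (a, b) >> - << (a, b') >>)
| TensZl c a b : tens_rel (<< (c *: a, b) >> - c *: << (a, b) >>)
| TensZr c a b : tens_rel (<< (a, c *: b) >> - c *: << (a, b) >>).

Definition tens := lquot tens_rel.
HB.instance Definition _ := GRing.Lmodule.on tens.

Definition ptens (a : A) (b : B) : tens := lpi tens_rel << (a, b) >>.

Lemma ptensDl a a' b : ptens (a + a') b = ptens a b + ptens a' b.
Proof.
rewrite -linearD; apply: lpi_eq; rewrite opprD addrA.
exact/mem_lspan/TensDl.
Qed.
Lemma ptensDr a b b' : ptens a (b + b') = ptens a b + ptens a b'.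
Proof.
rewrite -linearD; apply: lpi_eq; rewrite opprD addrA.
exact/mem_lspan/TensDr.
Qed.
Lemma ptensZl c a b : ptens (c *: a) b = c *: ptens a b.
Proof. by rewrite -linearZ; apply/lpi_eq/mem_lspan/TensZl. Qed.
Lemma ptensZr c a b : ptens a (c *: b) = c *: ptens a b.
Proof. by rewrite -linearZ; apply/lpi_eq/mem_lspan/TensZr. Qed.

End Tensor.

Section TensorMap.
Variables (R : comNzRingType) (A B C D : lmodType R).
Variables (f : {linear A -> C}) (g : {linear B -> D}).

Let pre : {linear _ -> tens C D} :=
  fglift (fun ab : (A * B)%type => ptens (f ab.1) (g ab.2)).

Lemma tens_map_subproof x : tens_rel x -> pre x = 0.
Proof.
case=> [a a' b|a b b'|c a b|c a b];
  rewrite !linearB ?linearZ /= !extendE /= ?scalerN.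
- by rewrite linearD ptensDl -addrA -opprD subrr.
- by rewrite linearD ptensDr -addrA -opprD subrr.
- by rewrite linearZ ptensZl subrr.
- by rewrite linearZ ptensZr subrr.
Qed.

Definition tens_map : tens A B -> tens C D :=
  descend tens_map_subproof.
HB.instance Definition _ := GRing.Linear.on tens_map.

Lemma tens_mapE a b : tens_map (ptens a b) = ptens (f a) (g b).
Proof. by rewrite [LHS]descendE [LHS]extendE. Qed.

End TensorMap.

Lemma tens_ext (R : comNzRingType) (A B U : lmodType R)
    (f g : {linear tens A B -> U}) :
  (forall a b, f (ptens a b) = g (ptens a b)) -> f =1 g.
Proof. by move=> fg; apply: lquot_free_ext => -[a b]; apply: fg. Qed.

Section MultiTensor.
Variables (R : comNzRingType) (I : Type) (M : I -> lmodType R).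

(* Multilinearity in the i-th slot, the other slots being fixed. *)
Inductive mtens_rel : {freeg (forall i, M i) / R} -> Prop :=
| MTensD (u v w : forall i, M i) i of w i = u i + v i
    & (forall j, j <> i -> u j = w j /\ v j = w j) :
    mtens_rel (<< w >> - << u >> - << v >>)
| MTensZ c (u w : forall i, M i) i of w i = c *: u i
    & (forall j, j <> i -> u j = w j) :
    mtens_rel (<< w >> - c *: << u >>).

Definition mtens := lquot mtens_rel.
HB.instance Definition _ := GRing.Lmodule.on mtens.

Definition pmtens (u : forall i, M i) : mtens := lpi mtens_rel << u >>.

Lemma pmtensD (u v w : forall i, M i) i : w i = u i + v i ->
  (forall j, j <> i -> u j = w j /\ v j = w j) ->
  pmtens w = pmtens u + pmtens v.
Proof.
move=> wi wj; rewrite -linearD; apply: lpi_eq; rewrite opprD addrA.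
exact/mem_lspan/(MTensD wi wj).
Qed.
Lemma pmtensZ c (u w : forall i, M i) i : w i = c *: u i ->
  (forall j, j <> i -> u j = w j) -> pmtens w = c *: pmtens u.
Proof.
by move=> wi wj; rewrite -linearZ; apply/lpi_eq/mem_lspan/(MTensZ wi wj).
Qed.

End MultiTensor.

Section MultiTensorMap.
Variables (R : comNzRingType) (I : Type) (M N : I -> lmodType R).
Variables (f : forall i, {linear M i -> N i}).

Let pre : {linear _ -> mtens N} :=
  fglift (fun u : (forall i, M i) => pmtens (fun i => f i (u i))).

Lemma mtens_map_subproof x : mtens_rel x -> pre x = 0.
Proof.
case=> [u v w i wi wj|c u w i wi wj];
  rewrite !linearB ?linearZ /= !extendE ?scalerN.
  rewrite (@pmtensD _ _ _ (fun i => f i (u i)) (fun i => f i (v i)) _ i).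
  - by rewrite -addrA -opprD subrr.
  - by rewrite wi linearD.
  - by move=> j /wj[-> ->].
rewrite (@pmtensZ _ _ _ c (fun i => f i (u i)) _ i) ?subrr //.
  by rewrite wi linearZ.
by move=> j /wj->.
Qed.

Definition mtens_map : mtens M -> mtens N :=
  descend mtens_map_subproof.
HB.instance Definition _ := GRing.Linear.on mtens_map.

Lemma mtens_mapE u : mtens_map (pmtens u) = pmtens (fun i => f i (u i)).
Proof. by rewrite [LHS]descendE [LHS]extendE. Qed.

End MultiTensorMap.

Lemma mtens_ext (R : comNzRingType) (I : Type) (M : I -> lmodType R)
    (U : lmodType R) (f g : {linear mtens M -> U}) :
  (forall u, f (pmtens u) = g (pmtens u)) -> f =1 g.
Proof. by move=> fg; apply: lquot_free_ext. Qed.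

Section BaseChange.
Variables (k R : comNzRingType) (tau : {rmorphism k -> R}) (M : lmodType k).

(* M (x)_{k, tau} R as an R-module, << m >> standing for m (x) 1. *)
Inductive bchange_rel : {freeg M / R} -> Prop :=
| BChangeD m m' : bchange_rel (<< m + m' >> - << m >> - << m' >>)
| BChangeZ c m : bchange_rel (<< c *: m >> - tau c *: << m >>).

Definition bchange := lquot bchange_rel.
HB.instance Definition _ := GRing.Lmodule.on bchange.

Definition pbchange (m : M) : bchange := lpi bchange_rel << m >>.

Lemma pbchangeD m m' : pbchange (m + m') = pbchange m + pbchange m'.
Proof.
rewrite -linearD; apply: lpi_eq; rewrite opprD addrA.
exact/mem_lspan/BChangeD.
Qed.
Lemma pbchangeZ c m : pbchange (c *: m) = tau c *: pbchange m.
Proof. by rewrite -linearZ; apply/lpi_eq/mem_lspan/BChangeZ. Qed.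

End BaseChange.

Section BaseChangeMap.
Variables (k R : comNzRingType) (tau : {rmorphism k -> R}).
Variables (M N : lmodType k) (f : {linear M -> N}).

Let pre : {linear _ -> bchange tau N} := fglift (fun m => pbchange tau (f m)).

Lemma bchange_map_subproof x : bchange_rel tau x -> pre x = 0.
Proof.
case=> [m m'|c m]; rewrite !linearB ?linearZ /= !extendE ?scalerN.
  by rewrite linearD pbchangeD -addrA -opprD subrr.
by rewrite linearZ pbchangeZ subrr.
Qed.

Definition bchange_map : bchange tau M -> bchange tau N :=
  descend bchange_map_subproof.
HB.instance Definition _ := GRing.Linear.on bchange_map.

Lemma bchange_mapE m : bchange_map (pbchange tau m) = pbchange tau (f m).
Proof. by rewrite [LHS]descendE [LHS]extendE. Qed.

End BaseChangeMap.
Arguments bchange_map {k R} tau {M N} f _.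

Lemma bchange_ext (k R : comNzRingType) (tau : {rmorphism k -> R})
    (M : lmodType k) (U : lmodType R) (f g : {linear bchange tau M -> U}) :
  (forall m, f (pbchange tau m) = g (pbchange tau m)) -> f =1 g.
Proof. by move=> fg; apply: lquot_free_ext. Qed.

Record linrep (R : nzRingType) (G : groupType) (V : lmodType R) := LinRep {
  lact :> G -> {linear V -> V};
  lact1 : forall v, lact 1%g v = v;
  lactM : forall g h v, lact (g * h)%g v = lact g (lact h v) }.

Section RepIso.
Variables (R : nzRingType) (G : groupType) (V W : lmodType R).

Definition rep_iso (rho : linrep G V) (sigma : linrep G W) : Prop :=
  exists2 f : {linear V -> W},
    bijective f & forall g v, f (rho g v) = sigma g (f v).

Definition irreducible_rep (rho : linrep G V) : Prop :=
  (exists v : V, v != 0) /\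
  forall W : {pred V}, submod_closed W ->
    (forall g, {in W, forall v, rho g v \in W}) ->
    (forall v, v \in W -> v = 0) \/ (forall v, v \in W).

End RepIso.

Section TensorRep.
Variables (R : comNzRingType) (G : groupType) (A B : lmodType R).
Variables (rho : linrep G A) (sigma : linrep G B).

Lemma tens_rep1 x : tens_map (rho 1%g) (sigma 1%g) x = x.
Proof.
apply: (@tens_ext _ _ _ _ _ idfun) => a b.
by rewrite [LHS]tens_mapE !lact1.
Qed.
Lemma tens_repM g h x : tens_map (rho (g * h)%g) (sigma (g * h)%g) x =
  tens_map (rho g) (sigma g) (tens_map (rho h) (sigma h) x).
Proof.
apply: (@tens_ext _ _ _ _ _
  (tens_map (rho g) (sigma g) \o tens_map (rho h) (sigma h))) => a b /=.
by rewrite !tens_mapE !lactM.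
Qed.
Definition tens_rep : linrep G (tens A B) := LinRep tens_rep1 tens_repM.

End TensorRep.

Section MultiTensorRep.
Variables (R : comNzRingType) (G : groupType) (I : Type).
Variables (M : I -> lmodType R) (rho : forall i, linrep G (M i)).

Lemma mtens_rep1 x : mtens_map (fun i => rho i 1%g) x = x.
Proof.
apply: (@mtens_ext _ _ _ _ _ idfun) => u; rewrite [LHS]mtens_mapE.
by congr pmtens; apply: functional_extensionality_dep => i; rewrite lact1.
Qed.
Lemma mtens_repM g h x : mtens_map (fun i => rho i (g * h)%g) x =
  mtens_map (fun i => rho i g) (mtens_map (fun i => rho i h) x).
Proof.
apply: (@mtens_ext _ _ _ _ _ (mtens_map (fun i => rho i g) \o
  mtens_map (fun i => rho i h))) => u /=; rewrite !mtens_mapE.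
by congr pmtens; apply: functional_extensionality_dep => i; rewrite lactM.
Qed.
Definition mtens_rep : linrep G (mtens M) := LinRep mtens_rep1 mtens_repM.

End MultiTensorRep.

Section BaseChangeRep.
Variables (k R : comNzRingType) (tau : {rmorphism k -> R}) (G : groupType).
Variables (M : lmodType k) (rho : linrep G M).

Lemma bchange_rep1 x : bchange_map tau (rho 1%g) x = x.
Proof.
apply: (@bchange_ext _ _ _ _ _ _ idfun) => m.
by rewrite [LHS]bchange_mapE lact1.
Qed.
Lemma bchange_repM g h x : bchange_map tau (rho (g * h)%g) x =
  bchange_map tau (rho g) (bchange_map tau (rho h) x).
Proof.
apply: (@bchange_ext _ _ _ _ _ _
  (bchange_map tau (rho g) \o bchange_map tau (rho h))) => m /=.
by rewrite !bchange_mapE lactM.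
Qed.
Definition bchange_rep : linrep G (bchange tau M) :=
  LinRep bchange_rep1 bchange_repM.

End BaseChangeRep.

Section FreeMap.
Variables (R : nzRingType) (K L : choiceType) (f : K -> L).

Definition freeg_map : {freeg K / R} -> {freeg L / R} :=
  fglift (fun k => << f k >>).
HB.instance Definition _ := GRing.Linear.on freeg_map.

Lemma freeg_mapE k : freeg_map << k >> = << f k >>.
Proof. exact: extendE. Qed.

End FreeMap.
Arguments freeg_map R {K L} f _.

Section RegularRep.
Variables (R : nzRingType) (G : groupType).

Lemma reg_rep1 x : freeg_map R (fun h : G => 1 * h)%g x = x.
Proof.
by apply: (@free_ext _ _ _ _ idfun) => h; rewrite /= freeg_mapE mul1g.
Qed.
Lemma reg_repM g h x : freeg_map R (fun k : G => g * h * k)%g x =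
  freeg_map R (fun k : G => g * k)%g (freeg_map R (fun k : G => h * k)%g x).
Proof.
apply: (@free_ext _ _ _ _ (freeg_map R (fun k : G => g * k)%g \o
  freeg_map R (fun k : G => h * k)%g)) => k /=.
by rewrite !freeg_mapE mulgA.
Qed.
Definition reg_rep : linrep G {freeg G / R} := LinRep reg_rep1 reg_repM.

End RegularRep.

Section Coinvariants.
Variables (R : nzRingType) (G : groupType) (Gam : {pred G}).
Variables (V : lmodType R) (rho : linrep G V).

Inductive coinv_rel : V -> Prop :=
| CoinvRel g v of g \in Gam : coinv_rel (rho g v - v).

Definition coinv := lquot coinv_rel.
HB.instance Definition _ := GRing.Lmodule.on coinv.

Definition coinv_pi : {linear V -> coinv} := lpi coinv_rel.

End Coinvariants.

Section CoinvariantsMap.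
Variables (R : nzRingType) (G : groupType) (Gam : {pred G}).
Variables (V W : lmodType R) (rho : linrep G V) (sigma : linrep G W).
Variables (f : {linear V -> W}).
Hypothesis f_equiv : forall g v, f (rho g v) = sigma g (f v).

Lemma coinv_map_subproof v :
  coinv_rel Gam rho v -> (coinv_pi Gam sigma \o f) v = 0.
Proof.
case=> g u Gg; rewrite /= linearB f_equiv -[0](linear0 (coinv_pi Gam sigma)).
by apply: lpi_eq; rewrite subr0; apply/mem_lspan/CoinvRel.
Qed.

Definition coinv_map : coinv Gam rho -> coinv Gam sigma :=
  descend coinv_map_subproof.
HB.instance Definition _ := GRing.Linear.on coinv_map.

Lemma coinv_mapE v : coinv_map (coinv_pi Gam rho v) = coinv_pi Gam sigma (f v).
Proof. exact: descendE. Qed.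

End CoinvariantsMap.
Arguments coinv_map {R G} Gam {V W rho sigma f} f_equiv _.

Section InducedCoinvariants.
Variables (R : comNzRingType) (G : groupType) (Gam : {pred G}).
Variables (V : lmodType R) (rho : linrep G V).

Definition indcoinv := coinv Gam (tens_rep (reg_rep R G) rho).
HB.instance Definition _ := GRing.Lmodule.on indcoinv.

Definition pindcoinv (h : G) (v : V) : indcoinv :=
  coinv_pi Gam (tens_rep (reg_rep R G) rho) (ptens << h >> v).

Definition rmul_pre (g : G) :
    {linear tens {freeg G / R} V -> tens {freeg G / R} V} :=
  tens_map (freeg_map R (fun h : G => h * g)%g) idfun.

Lemma rmul_pre_equiv g k x :
  rmul_pre g (tens_rep (reg_rep R G) rho k x) =
  tens_rep (reg_rep R G) rho k (rmul_pre g x).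
Proof.
apply: (@tens_ext _ _ _ _ (rmul_pre g \o tens_rep (reg_rep R G) rho k)
  (tens_rep (reg_rep R G) rho k \o rmul_pre g)) => a v /=.
rewrite /rmul_pre !tens_mapE /=; congr ptens.
apply: (@free_ext _ _ _
  (freeg_map R (fun h : G => h * g)%g \o freeg_map R (fun h : G => k * h)%g)
  (freeg_map R (fun h : G => k * h)%g \o freeg_map R (fun h : G => h * g)%g)).
by move=> h /=; rewrite !freeg_mapE mulgA.
Qed.

Definition rmulg (g : G) : {linear indcoinv -> indcoinv} :=
  coinv_map Gam (rmul_pre_equiv g).

Lemma rmulgE g h v : rmulg g (pindcoinv h v) = pindcoinv (h * g)%g v.
Proof.
by rewrite [LHS]coinv_mapE [X in coinv_pi _ _ X]tens_mapE /= freeg_mapE.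
Qed.

Definition rmul (x : {freeg G / R}) (n : indcoinv) : indcoinv :=
  fglift (fun g => rmulg g n) x.

Lemma rmul_is_linear x : linear (rmul x).
Proof.
move=> a m n; rewrite /rmul; elim/freeg_lin_ind: x => [|b g x IHx].
  by rewrite !linear0 addr0.
have E p : fglift (fun g => rmulg g p) (b *: << g >> + x) =
    b *: rmulg g p + fglift (fun g => rmulg g p) x.
  rewrite -[in RHS](extendE (fun g => rmulg g p)).
  exact: (linearP (fglift (fun g => rmulg g p))).
rewrite !E IHx linearP !scalerDr !scalerA (mulrC a).
by rewrite addrACA.
Qed.
HB.instance Definition _ x := GRing.isLinear.Build R indcoinv indcoinv _
  (rmul x) (rmul_is_linear x).

Definition rmul_img (x : {freeg G / R}) : {pred indcoinv} :=
  [pred n | `[< exists m, n = rmul x m >]].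

Lemma rmul_img_submod x : submod_closed (rmul_img x).
Proof.
split=> [|a m n /asboolP[m' ->] /asboolP[n' ->]]; apply/asboolP.
  by exists 0; rewrite linear0.
by exists (a *: m' + n'); rewrite linearP.
Qed.
HB.instance Definition _ x :=
  GRing.isSubmodClosed.Build R indcoinv (rmul_img x) (rmul_img_submod x).

End InducedCoinvariants.
Arguments rmul_img {R G} Gam {V} rho x.

Section Submodules.
Variables (R : nzRingType) (V : lmodType R).

Section Sum.
Variables (P Q : submodClosed V).

Definition submod_sum : {pred V} :=
  [pred w | `[< exists2 u, u \in P & exists2 v, v \in Q & w = u + v >]].

Lemma submod_sum_closed : submod_closed submod_sum.
Proof.
split=> [|a x y /asboolP[u Pu [v Qv ->]] /asboolP[u' Pu' [v' Qv' ->]]];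
  apply/asboolP.
  by exists 0; rewrite ?rpred0 //; exists 0; rewrite ?rpred0 // addr0.
exists (a *: u + u'); first by rewrite rpredD ?rpredZ.
exists (a *: v + v'); first by rewrite rpredD ?rpredZ.
by rewrite scalerDr addrACA.
Qed.
HB.instance Definition _ :=
  GRing.isSubmodClosed.Build R V submod_sum submod_sum_closed.

End Sum.

Variable P : submodClosed V.

Record submodule := Submodule { incl_val : V; _ : incl_val \in P }.
HB.instance Definition _ := [isSub for incl_val].
HB.instance Definition _ := [Choice of submodule by <:].
HB.instance Definition _ := [SubChoice_isSubLmodule of submodule by <:].

Definition incl : {linear submodule -> V} := val.

End Submodules.

Definition short_exact (R : nzRingType) (A B C : lmodType R)
    (f : {linear A -> B}) (g : {linear B -> C}) : Prop :=
  [/\ injective f, forall b, g b = 0 <-> exists a, b = f a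
    & forall c, exists b, c = g b].

Record gaussInt := GaussInt { gre : int; gim : int }.

Definition gauss_pair (x : gaussInt) := (gre x, gim x).
Definition pair_gauss (p : (int * int)%type) := GaussInt p.1 p.2.
Lemma gauss_pairK : cancel gauss_pair pair_gauss. Proof. by case. Qed.
HB.instance Definition _ := Choice.copy gaussInt (can_type gauss_pairK).

Definition gadd x y := GaussInt (gre x + gre y) (gim x + gim y).
Definition gopp x := GaussInt (- gre x) (- gim x).
Definition gmul x y :=
  GaussInt (gre x * gre y - gim x * gim y) (gre x * gim y + gim x * gre y).

Lemma gaddA : associative gadd.
Proof. by move=> [? ?] [? ?] [? ?]; congr GaussInt; rewrite /= addrA. Qed.
Lemma gaddC : commutative gadd.
Proof. by move=> [? ?] [? ?]; congr GaussInt; rewrite /= addrC. Qed.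
Lemma gadd0 : left_id (GaussInt 0 0) gadd.
Proof. by move=> [? ?]; congr GaussInt; rewrite /= add0r. Qed.
Lemma gaddN : left_inverse (GaussInt 0 0) gopp gadd.
Proof. by move=> [? ?]; congr GaussInt; rewrite /= addNr. Qed.
HB.instance Definition _ :=
  GRing.isZmodule.Build gaussInt gaddA gaddC gadd0 gaddN.

Lemma gmulA : associative gmul.
Proof. by move=> [? ?] [? ?] [? ?]; congr GaussInt => /=; ring. Qed.
Lemma gmulC : commutative gmul.
Proof. by move=> [? ?] [? ?]; congr GaussInt => /=; ring. Qed.
Lemma gmul1 : left_id (GaussInt 1 0) gmul.
Proof. by move=> [? ?]; congr GaussInt => /=; ring. Qed.
Lemma gmulDl : left_distributive gmul +%R.
Proof. by move=> [? ?] [? ?] [? ?]; congr GaussInt => /=; ring. Qed.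
Lemma gone_neq0 : GaussInt 1 0 != 0. Proof. by []. Qed.
HB.instance Definition _ := GRing.Zmodule_isComNzRing.Build gaussInt
  gmulA gmulC gmul1 gmulDl gone_neq0.

Definition gi : gaussInt := GaussInt 0 1.

Lemma giM : gi * gi = -1. Proof. by []. Qed.

(* The units of A, each carried together with its inverse. *)
Section Units.
Variable A : nzRingType.

Record units := Units {
  units_pair : (A * A)%type;
  _ : (units_pair.1 * units_pair.2 == 1) &&
      (units_pair.2 * units_pair.1 == 1) }.
HB.instance Definition _ := [isSub for units_pair].
HB.instance Definition _ := [Choice of units by <:].

Definition uval (u : units) : A := (units_pair u).1.
Definition uinvval (u : units) : A := (units_pair u).2.

Lemma uvalV u : uval u * uinvval u = 1.
Proof. by have /andP[/eqP] := valP u. Qed.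
Lemma uVval u : uinvval u * uval u = 1.
Proof. by have /andP[_ /eqP] := valP u. Qed.

Lemma uval_inj : injective uval.
Proof.
move=> u v uv; apply/val_inj; rewrite /= [LHS]surjective_pairing.
rewrite [RHS]surjective_pairing; congr (_, _) => //.
rewrite -[LHS]/(uinvval u) -[RHS]/(uinvval v).
by rewrite -[uinvval u]mulr1 -(uvalV v) -uv mulrA uVval mul1r.
Qed.

Lemma units_subproof (x y : A) : x * y = 1 -> y * x = 1 ->
  ((x, y).1 * (x, y).2 == 1) && ((x, y).2 * (x, y).1 == 1).
Proof. by move=> -> ->; rewrite eqxx. Qed.
Definition mkunit (x y : A) (xy : x * y = 1) (yx : y * x = 1) : units :=
  Units (units_subproof xy yx).

Definition uone : units := mkunit (mulr1 1) (mulr1 1).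
Definition uinv (u : units) : units := mkunit (uVval u) (uvalV u).

Lemma umul_subproof (u v : units) :
  (uval u * uval v) * (uinvval v * uinvval u) = 1.
Proof. by rewrite mulrA -(mulrA (uval u)) uvalV mulr1 uvalV. Qed.
Lemma umul_subproofV (u v : units) :
  (uinvval v * uinvval u) * (uval u * uval v) = 1.
Proof. by rewrite mulrA -(mulrA (uinvval v)) uVval mulr1 uVval. Qed.
Definition umul (u v : units) : units :=
  mkunit (umul_subproof u v) (umul_subproofV u v).

Lemma umulA : associative umul.
Proof. by move=> u v w; apply: uval_inj; rewrite /uval /= mulrA. Qed.
Lemma umul1 : left_id uone umul.
Proof. by move=> u; apply: uval_inj; rewrite /uval /= mul1r. Qed.
Lemma umulr1 : right_id uone umul.
Proof. by move=> u; apply: uval_inj; rewrite /uval /= mulr1. Qed.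
Lemma umulV : left_inverse uone uinv umul.
Proof. by move=> u; apply: uval_inj; apply: uVval. Qed.
Lemma umulrV : right_inverse uone uinv umul.
Proof. by move=> u; apply: uval_inj; apply: uvalV. Qed.
HB.instance Definition _ := isGroup.Build units umulA umul1 umulr1 umulV umulrV.

Lemma uvalM (u v : units) : uval (u * v)%g = uval u * uval v. Proof. by []. Qed.
Lemma uval1 : uval 1%g = 1. Proof. by []. Qed.

End Units.

Definition GL2 (A : nzRingType) := units 'M[A]_2.
HB.instance Definition _ (A : nzRingType) := Group.on (GL2 A).

Definition GLmx (A : nzRingType) (g : GL2 A) : 'M[A]_2 := uval g.
Coercion GLmx : GL2 >-> matrix.

Definition mx2 (A : nzRingType) (a b c d : A) : 'M[A]_2 :=
  \matrix_(i, j) if i == 0 then (if j == 0 then a else b)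
                 else (if j == 0 then c else d).

Lemma mx2M (A : nzRingType) (a b c d a' b' c' d' : A) :
  mx2 a b c d * mx2 a' b' c' d' =
  mx2 (a * a' + b * c') (a * b' + b * d') (c * a' + d * c') (c * b' + d * d').
Proof.
apply/matrixP => i j; rewrite !mxE !big_ord_recl big_ord0 !mxE /= addr0.
by case: i j => [[|[|i]] hi] [[|[|j]] hj].
Qed.

Lemma mx2_1 (A : nzRingType) : mx2 1 0 0 1 = 1 :> 'M[A]_2.
Proof.
apply/matrixP => i j; rewrite !mxE.
by case: i j => [[|[|i]] hi] [[|[|j]] hj].
Qed.

Section GLMap.
Variables (A B : nzRingType) (phi : {rmorphism A -> B}).

Lemma GLmap_subproof (g : GL2 A) :
  map_mx phi (uval g) * map_mx phi (uinvval g) = 1.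
Proof. by rewrite -[LHS](map_mxM phi) [_ *m _]uvalV map_mx1. Qed.
Lemma GLmap_subproofV (g : GL2 A) :
  map_mx phi (uinvval g) * map_mx phi (uval g) = 1.
Proof. by rewrite -[LHS](map_mxM phi) [_ *m _]uVval map_mx1. Qed.
Definition GLmap (g : GL2 A) : GL2 B :=
  mkunit (GLmap_subproof g) (GLmap_subproofV g).

Lemma GLmapE g : GLmap g = map_mx phi g :> 'M_2. Proof. by []. Qed.

Lemma GLmap1 : GLmap 1%g = 1%g.
Proof. by apply: uval_inj; rewrite /uval /= map_mx1. Qed.
Lemma GLmapM g h : GLmap (g * h)%g = (GLmap g * GLmap h)%g.
Proof. by apply: uval_inj; apply: (map_mxM phi). Qed.

Variables (R : nzRingType) (V : lmodType R) (rho : linrep (GL2 B) V).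

Lemma pull_rep1 v : rho (GLmap 1%g) v = v.
Proof. by rewrite GLmap1 lact1. Qed.
Lemma pull_repM g h v :
  rho (GLmap (g * h)%g) v = rho (GLmap g) (rho (GLmap h) v).
Proof. by rewrite GLmapM lactM. Qed.
Definition pull_rep : linrep (GL2 A) V := LinRep pull_rep1 pull_repM.

End GLMap.

Lemma matJ_subproof : mx2 gi 0 0 1 * mx2 (- gi) 0 0 1 = 1 :> 'M[gaussInt]_2.
Proof. by rewrite mx2M -mx2_1; congr mx2. Qed.
Lemma matJ_subproofV : mx2 (- gi) 0 0 1 * mx2 gi 0 0 1 = 1 :> 'M[gaussInt]_2.
Proof. by rewrite mx2M -mx2_1; congr mx2. Qed.
Definition matJ : GL2 gaussInt := mkunit matJ_subproof matJ_subproofV.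

Lemma matS_subproof : mx2 0 gi 1 0 * mx2 0 1 (- gi) 0 = 1 :> 'M[gaussInt]_2.
Proof. by rewrite mx2M -mx2_1; congr mx2. Qed.
Lemma matS_subproofV : mx2 0 1 (- gi) 0 * mx2 0 gi 1 0 = 1 :> 'M[gaussInt]_2.
Proof. by rewrite mx2M -mx2_1; congr mx2. Qed.
Definition matS : GL2 gaussInt := mkunit matS_subproof matS_subproofV.

Lemma matL_subproof : mx2 1 (-1) 1 0 * mx2 0 1 (-1) 1 = 1 :> 'M[gaussInt]_2.
Proof. by rewrite mx2M -mx2_1; congr mx2. Qed.
Lemma matL_subproofV : mx2 0 1 (-1) 1 * mx2 1 (-1) 1 0 = 1 :> 'M[gaussInt]_2.
Proof. by rewrite mx2M -mx2_1; congr mx2. Qed.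
Definition matL : GL2 gaussInt := mkunit matL_subproof matL_subproofV.

Definition gdvd (d a : gaussInt) : Prop := exists c, a = c * d.

(* gcd (a, b) = 1: every common divisor of a and b divides 1. *)
Definition unimodular (v : 'cV[gaussInt]_2) : Prop :=
  forall d, gdvd d (v 0 0) -> gdvd d (v 1 0) -> gdvd d 1.

Record ucol := UCol {
  ucol_val :> 'cV[gaussInt]_2;
  _ : `[< unimodular ucol_val >] }.
HB.instance Definition _ := [isSub for ucol_val].
HB.instance Definition _ := [Choice of ucol by <:].

Lemma unimodularM (g : GL2 gaussInt) (v : ucol) :
  `[< unimodular (GLmx g *m v) >].
Proof.
case: v => v /= /asboolP vu; apply/asboolP => d d0 d1.
have dv i : gdvd d (v i 0).
  have -> : v = (uinvval g : 'M_2) *m (GLmx g *m v).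
    by rewrite mulmxA [_ *m GLmx g]uVval mul1mx.
  have [c0 e0] := d0; have [c1 e1] := d1.
  exists ((uinvval g : 'M_2) i 0 * c0 + (uinvval g : 'M_2) i 1 * c1).
  rewrite mxE !big_ord_recl big_ord0 addr0.
  rewrite (_ : fintype.lift ord0 ord0 = 1); last exact/val_inj.
  by rewrite e0 e1 mulrDl !mulrA.
exact: vu.
Qed.
Definition umulv (g : GL2 gaussInt) (v : ucol) : ucol := UCol (unimodularM g v).

Lemma umulv1 v : umulv 1%g v = v.
Proof. by apply: val_inj; rewrite /= mul1mx. Qed.
Lemma umulvM g h v : umulv (g * h)%g v = umulv g (umulv h v).
Proof. by apply: val_inj; rewrite /= mulmxA. Qed.

Lemma ucol0_subproof : `[< unimodular (delta_mx 1 0) >].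
Proof. by apply/asboolP => d; rewrite !mxE. Qed.
(* 0 is the column (0, 1)^T and oo the column (1, 0)^T. *)
Definition ucol0 : ucol := UCol ucol0_subproof.
Lemma ucoloo_subproof : `[< unimodular (delta_mx 0 0) >].
Proof. by apply/asboolP => d; rewrite !mxE. Qed.
Definition ucoloo : ucol := UCol ucoloo_subproof.

Section Steinberg.
Variable R : comNzRingType.

Inductive st_rel : {freeg (ucol * ucol)%type / R} -> Prop :=
| StAnti v1 v2 : st_rel (<< (v2, v1) >> + << (v1, v2) >>)
| StDegen (v1 v2 : ucol) of \det (@row_mx gaussInt 2 1 1 v1 v2) = 0 :
    st_rel << (v1, v2) >>
| StCocycle v1 v2 v3 :
    st_rel (<< (v1, v3) >> - << (v1, v2) >> - << (v2, v3) >>).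

Definition steinberg := lquot st_rel.
HB.instance Definition _ := GRing.Lmodule.on steinberg.

Definition st_sym (v1 v2 : ucol) : steinberg := lpi st_rel << (v1, v2) >>.

Let pre (g : GL2 gaussInt) :
    {linear {freeg (ucol * ucol)%type / R} -> steinberg} :=
  fglift (fun v : (ucol * ucol)%type => st_sym (umulv g v.1) (umulv g v.2)).

Lemma st_act_subproof g x : st_rel x -> pre g x = 0.
Proof.
case=> [v1 v2|v1 v2 d0|v1 v2 v3]; rewrite ?linearD ?linearN /= !extendE /=.
- rewrite -linearD -[0](linear0 (lpi st_rel)); apply: lpi_eq; rewrite subr0.
  exact/mem_lspan/StAnti.
- rewrite -[0](linear0 (lpi st_rel)); apply: lpi_eq; rewrite subr0.
  apply/mem_lspan/StDegen => /=.
  by rewrite -mul_mx_row det_mulmx d0 mulr0.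
rewrite -!linearB -[0](linear0 (lpi st_rel)); apply: lpi_eq; rewrite subr0.
exact/mem_lspan/StCocycle.
Qed.
Definition st_act g : steinberg -> steinberg := descend (st_act_subproof g).
HB.instance Definition _ g := GRing.Linear.on (st_act g).

Lemma st_actE g v1 v2 :
  st_act g (st_sym v1 v2) = st_sym (umulv g v1) (umulv g v2).
Proof. by rewrite [LHS]descendE [LHS]extendE. Qed.

Lemma st_rep1 x : st_act 1%g x = x.
Proof.
apply: (@lquot_free_ext _ _ _ _ (st_act 1%g) idfun) => -[v1 v2] /=.
by rewrite [LHS]st_actE !umulv1.
Qed.
Lemma st_repM g h x : st_act (g * h)%g x = st_act g (st_act h x).
Proof.
apply: (@lquot_free_ext _ _ _ _ (st_act (g * h)%g) (st_act g \o st_act h)).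
by case=> v1 v2 /=; rewrite [LHS]st_actE !umulvM -2!st_actE.
Qed.
Definition st_rep : linrep (GL2 gaussInt) steinberg := LinRep st_rep1 st_repM.

Definition to_st : {freeg (GL2 gaussInt) / R} -> steinberg :=
  fglift (fun h => st_sym (umulv h ucol0) (umulv h ucoloo)).
HB.instance Definition _ := GRing.Linear.on to_st.

Variables (Gam : {pred GL2 gaussInt}) (V : lmodType R).
Variable rho : linrep (GL2 gaussInt) V.

Definition to_st_tens :
    {linear tens {freeg (GL2 gaussInt) / R} V -> tens steinberg V} :=
  tens_map to_st idfun.

Lemma to_st_tens_equiv g x :
  to_st_tens (tens_rep (reg_rep R (GL2 gaussInt)) rho g x) =
  tens_rep st_rep rho g (to_st_tens x).
Proof.
apply: (@tens_ext _ _ _ _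
  (to_st_tens \o tens_rep (reg_rep R (GL2 gaussInt)) rho g)
  (tens_rep st_rep rho g \o to_st_tens)) => a v /=.
rewrite /to_st_tens /= !tens_mapE /=; congr ptens.
apply: (@free_ext _ _ _ (to_st \o reg_rep R (GL2 gaussInt) g)
  (st_act g \o to_st)).
move=> h /=; rewrite freeg_mapE /to_st !extendE st_actE.
by rewrite !umulvM.
Qed.

Definition st_coinv := coinv Gam (tens_rep st_rep rho).
HB.instance Definition _ := GRing.Lmodule.on st_coinv.

Definition indcoinv_to_st : {linear indcoinv Gam rho -> st_coinv} :=
  coinv_map Gam to_st_tens_equiv.

Lemma indcoinv_to_stE h v : indcoinv_to_st (pindcoinv Gam rho h v) =
  coinv_pi Gam (tens_rep st_rep rho)
    (ptens (st_sym (umulv h ucol0) (umulv h ucoloo)) v).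
Proof.
by rewrite [LHS]coinv_mapE [X in coinv_pi _ _ X]tens_mapE /= /to_st extendE.
Qed.

End Steinberg.

Section DetSym.
Variables (k : comNzRingType) (a n : nat).

(* P(X, Y) |-> P(dX - bY, -cX + aY) for g = (a b; c d), with X = 'X_0 and
   Y = 'X_1. *)
Definition sym_vars (g : 'M[k]_2) : 2.-tuple {mpoly k[2]} :=
  [tuple g 1 1 *: 'X_0 - g 0 1 *: 'X_1; - g 1 0 *: 'X_0 + g 0 0 *: 'X_1].

Lemma sym_vars_homog g i : tnth (sym_vars g) i \is 1.-homog.
Proof.
have X1 (j : 'I_2) : ('X_j : {mpoly k[2]}) \is 1.-homog.
  by rewrite dhomogX; apply/eqP/mdeg1.
case: i => [[|[|i]] hi] //; rewrite (tnth_nth 0) /=.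
  by rewrite rpredB ?rpredZ.
by rewrite rpredD ?rpredZ.
Qed.

Lemma sym_homog g (P : dhomog 2 k n) :
  (mpoly_of_dhomog P) \mPo sym_vars g \is n.-homog.
Proof.
rewrite comp_mpolyE big_seq rpred_sum // => m mP; apply: rpredZ.
have <- : mdeg m = n by have /dhomogP := valP P; apply.
rewrite mdegE !big_ord_recl !big_ord0 addn0 mulr1.
by apply: dhomogM; rewrite -[X in X.-homog]mul1n;
  apply/dhomogMn/sym_vars_homog.
Qed.

Definition sym_comp g (P : dhomog 2 k n) : dhomog 2 k n :=
  DHomog (sym_homog g P).

Definition detsym_act (g : 'M[k]_2) (P : dhomog 2 k n) : dhomog 2 k n :=
  \det g ^+ a *: sym_comp g P.

Lemma detsym_act_is_linear g : linear (detsym_act g).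
Proof.
move=> c P Q; apply: val_inj; rewrite /detsym_act /=.
by rewrite linearP /= scalerDr !scalerA mulrC.
Qed.
HB.instance Definition _ g := GRing.isLinear.Build k _ _ _
  (detsym_act g) (detsym_act_is_linear g).

Lemma sym_vars1 : sym_vars 1 = [tuple 'X_i | i < 2].
Proof.
apply: eq_from_tnth => -[[|[|i]] hi] //; rewrite tnth_mktuple (tnth_nth 0) /=.
  rewrite !mxE /= scale1r scale0r subr0; congr ('X__).
  exact/val_inj.
rewrite !mxE /= oppr0 scale1r scale0r add0r; congr ('X__).
exact/val_inj.
Qed.

Lemma sym_varsM (g h : 'M[k]_2) i :
  tnth (sym_vars h) i \mPo sym_vars g = tnth (sym_vars (g * h)) i.
Proof.
have X0 : 'X_0 \mPo sym_vars g = tnth (sym_vars g) 0.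
  by rewrite comp_mpolyXU (tnth_nth 0).
have X1 : 'X_1 \mPo sym_vars g = tnth (sym_vars g) 1.
  by rewrite comp_mpolyXU (tnth_nth 0).
have gh u v : (g * h) u v = g u 0 * h 0 v + g u 1 * h 1 v.
  rewrite mxE !big_ord_recl big_ord0 addr0.
  by rewrite (_ : fintype.lift ord0 ord0 = 1) //; apply: val_inj.
case: i => [[|[|i]] hi] //; rewrite !(tnth_nth 0) /=.
  rewrite comp_mpolyB !comp_mpolyZ X0 X1 !(tnth_nth 0) /= !gh.
  by rewrite -!mul_mpolyC !rmorphD !rmorphM !rmorphN /=; ring.
rewrite comp_mpolyD !comp_mpolyZ X0 X1 !(tnth_nth 0) /= !gh.
by rewrite -!mul_mpolyC !rmorphN !rmorphD !rmorphM /=; ring.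
Qed.

Lemma mPo_sym_vars (g h : 'M[k]_2) (P : {mpoly k[2]}) :
  (P \mPo sym_vars h) \mPo sym_vars g = P \mPo sym_vars (g * h).
Proof.
rewrite [in LHS](comp_mpolyE P) [RHS]comp_mpolyE raddf_sum /=.
apply: eq_bigr => m _; rewrite comp_mpolyZ rmorph_prod /=; congr (_ *: _).
by apply: eq_bigr => i _; rewrite rmorphXn /= sym_varsM.
Qed.

Lemma detsym1 P : detsym_act (1%g : GL2 k) P = P.
Proof.
apply: val_inj; rewrite /detsym_act /= [GLmx _](_ : _ = 1%:M) //.
by rewrite det1 expr1n scale1r sym_vars1 comp_mpoly_id.
Qed.
Lemma detsymM (g h : GL2 k) P :
  detsym_act ((g * h)%g : GL2 k) P = detsym_act g (detsym_act h P).
Proof.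
apply: val_inj; rewrite /detsym_act /= comp_mpolyZ mPo_sym_vars scalerA.
rewrite [GLmx (g * h)%g](_ : _ = GLmx g *m GLmx h) //.
by rewrite det_mulmx exprMn.
Qed.
Definition detsym_rep : linrep (GL2 k) (dhomog 2 k n) :=
  @LinRep k (GL2 k) (dhomog 2 k n) (fun g : GL2 k => detsym_act g)
    detsym1 detsymM.

End DetSym.

Record prime_above (l : nat) := PrimeAbove {
  pa_pred : gaussInt -> bool;
  pa_ideal : idealr_closed pa_pred;
  pa_prime : prime_idealr_closed pa_pred;
  pa_mem : l%:R \in pa_pred }.
HB.instance Definition _ l (p : prime_above l) :=
  isIdealr.Build gaussInt (pa_pred p) (pa_ideal p).

Lemma prime_above_eq l (p q : prime_above l) : pa_pred p =i pa_pred q -> p = q.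
Proof.
case: p q => [p p1 p2 p3] [q q1 q2 q3] /= pq.
have {}pq : p = q by apply: functional_extensionality_dep => x; apply: pq.
subst q; congr PrimeAbove; exact: Prop_irrelevance.
Qed.

Definition residue l (p : prime_above l) :=
  {ideal_quot (pa_pred p : {pred gaussInt})}.
HB.instance Definition _ l (p : prime_above l) :=
  GRing.ComNzRing.on (residue p).

Lemma rmorphism_eq (A B : nzRingType) (f g : {rmorphism A -> B}) :
  f =1 g -> f = g.
Proof.
case: f g => [f [[fD] [fM]]] [g [[gD] [gM]]] /= fg.
have {}fg : f = g by apply: functional_extensionality_dep => x; apply: fg.
by subst g; rewrite (Prop_irrelevance fD gD) (Prop_irrelevance fM gM).
Qed.

Definition ell_ideal (l : nat) of prime l : {pred gaussInt} :=
  [pred x | `[< gdvd l%:R x >]].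

Lemma gnatE (n : nat) : n%:R = GaussInt n%:Z 0 :> gaussInt.
Proof.
elim: n => // n IHn; rewrite -addn1 natrD IHn.
by rewrite -[LHS]/(GaussInt (n%:Z + 1) 0) -PoszD.
Qed.

Section ResidueMaps.
Variables (l : nat) (lp : prime l).

Lemma ell_idealr : idealr_closed (ell_ideal lp).
Proof.
split=> [||a x y /asboolP[u ->] /asboolP[v ->]].
- by apply/asboolP; exists 0; rewrite mul0r.
- apply/asboolP => -[c]; rewrite gnatE => /(congr1 gre) /= /eqP.
  rewrite mulr0 subr0 => /eqP e; have := prime_gt1 lp.
  have /(congr1 absz) := e; rewrite abszM /= => /esym/eqP.
  by rewrite muln_eq1 => /andP[_ /eqP->].
by apply/asboolP; exists (a * u + v); rewrite mulrDl mulrA.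
Qed.
HB.instance Definition _ := isIdealr.Build gaussInt (ell_ideal lp) ell_idealr.

Definition Omod := {ideal_quot (ell_ideal lp)}.
HB.instance Definition _ := GRing.ComNzRing.on Omod.

Definition red : gaussInt -> Omod := \pi_({ideal_quot (ell_ideal lp)}).
Lemma red_zmod_morphism : zmod_morphism red.
Proof. exact: pi_is_zmod_morphism. Qed.
Lemma red_monoid_morphism : monoid_morphism red.
Proof. exact: pi_is_monoid_morphism. Qed.
HB.instance Definition _ := GRing.isZmodMorphism.Build gaussInt Omod red
  red_zmod_morphism.
HB.instance Definition _ := GRing.isMonoidMorphism.Build gaussInt Omod red
  red_monoid_morphism.

Variable p : prime_above l.

Definition res : gaussInt -> residue p :=
  \pi_({ideal_quot (pa_pred p : {pred gaussInt})}).
Lemma res_zmod_morphism : zmod_morphism res.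
Proof. exact: pi_is_zmod_morphism. Qed.
Lemma res_monoid_morphism : monoid_morphism res.
Proof. exact: pi_is_monoid_morphism. Qed.
HB.instance Definition _ := GRing.isZmodMorphism.Build gaussInt (residue p) res
  res_zmod_morphism.
HB.instance Definition _ :=
  GRing.isMonoidMorphism.Build gaussInt (residue p) res
  res_monoid_morphism.

Lemma res0 x : red x = 0 -> res x = 0.
Proof.
move=> /eqP; rewrite -[0](rmorph0 red) -[_ == _]Quotient.idealrBE subr0.
by move=> /asboolP[c ->]; rewrite rmorphM; apply/eqP;
  rewrite -[0](rmorph0 res) -rmorphM -[_ == _]Quotient.idealrBE subr0;
  apply: idealMr; apply: pa_mem.
Qed.

(* Independent of the representative, since p contains l: see red_resE. *)
Definition red_res (x : Omod) : residue p := res (repr x).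

Lemma red_resE x : red_res (red x) = res x.
Proof.
apply/eqP; rewrite -subr_eq0 -rmorphB; apply/eqP/res0.
by rewrite rmorphB /= [red (repr _)]reprK subrr.
Qed.

Lemma OmodP (P : Omod -> Prop) : (forall x, P (red x)) -> forall x, P x.
Proof. by move=> Px x; rewrite -[x]reprK. Qed.

Lemma red_res_zmod_morphism : zmod_morphism red_res.
Proof.
by elim/OmodP => x; elim/OmodP => y; rewrite -rmorphB !red_resE rmorphB.
Qed.
Lemma red_res_monoid_morphism : monoid_morphism red_res.
Proof.
split; first by rewrite -[1](rmorph1 red) red_resE rmorph1.
by elim/OmodP => x; elim/OmodP => y; rewrite -rmorphM !red_resE rmorphM.
Qed.
HB.instance Definition _ := GRing.isZmodMorphism.Build Omod (residue p) red_res
  red_res_zmod_morphism.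
HB.instance Definition _ := GRing.isMonoidMorphism.Build Omod (residue p)
  red_res red_res_monoid_morphism.

End ResidueMaps.

Section SerreWeight.
Variables (l : nat) (lp : prime l) (R : comNzRingType).

(* Z[i] / p is a field, so these ring morphisms are injective. *)
Definition embedding (p : prime_above l) := {rmorphism residue p -> R}.

Section Explicit.
Variables (a b : forall p : prime_above l, embedding p -> nat).

Definition local_weight (p : prime_above l) : lmodType R :=
  mtens (fun tau : embedding p =>
    bchange tau (dhomog 2 (residue p) (b tau).-1)).

Definition local_weight_rep (p : prime_above l) :
    linrep (GL2 (residue p)) (local_weight p) :=
  mtens_rep (fun tau : embedding p =>
    bchange_rep tau (detsym_rep (residue p) (a tau) (b tau).-1)).

Definition explicit_weight : lmodType R := mtens local_weight.

(* Z[i] / l is the product of the residue fields, and the factor indexed by p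
   carries the action of GL_2(Z[i] / l) through GL_2(Z[i] / p). *)
Definition explicit_weight_rep : linrep (GL2 (Omod lp)) explicit_weight :=
  mtens_rep (fun p => pull_rep (@red_res l lp p) (local_weight_rep p)).

End Explicit.

(* Irreducibility of rho takes the place of the usual upper bound on b. As
   \det g has finite order, natural exponents a cover all integers. *)
Definition serre_weight (V : lmodType R) (rho : linrep (GL2 (Omod lp)) V) :
    Prop :=
  irreducible_rep rho /\
  exists a b : forall p : prime_above l, embedding p -> nat,
    (forall p (tau : embedding p), 0 < b p tau)%N /\
    rep_iso rho (explicit_weight_rep a b).

End SerreWeight.

(* x lies in the square of the ideal p. *)
Definition ideal_sqr (p : {pred gaussInt}) (x : gaussInt) : Prop :=
  exists s : seq (gaussInt * gaussInt),
    (forall y, y \in s -> (y.1 \in p) && (y.2 \in p)) /\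
    x = \sum_(y <- s) y.1 * y.2.

Definition unramified (l : nat) : Prop :=
  forall p : prime_above l, ~ ideal_sqr (pa_pred p) l%:R.

Definition congruence_subgroup (Gam : {pred GL2 gaussInt}) : Prop :=
  group_closed Gam /\
  exists n : {pred gaussInt}, [/\ idealr_closed n, exists2 x, x != 0 & x \in n &
    forall g : GL2 gaussInt,
      (forall i j, (GLmx g - 1%:M) i j \in n) -> g \in Gam].

Definition algebraic_closure_Fp (l : nat) (R : closedFieldType)
    (iota : {rmorphism 'F_l -> R}) : Prop :=
  forall x : R, algebraicOver iota x.

(* Main.v *)
(* Read h in GL_2(Z[i]) as an oriented edge from the cusp h(0) to the cusp h(oo).
   The point is that a function E on edges satisfying the relations dual to
   I - J, I + S and I + L + L^2 is the coboundary of a function f on cusps.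
   Such an f is built by Euclidean descent on the norm of the lower entry: every
   cusp of nonzero height has a neighbour of smaller height, and two lower
   neighbours of the same cusp are linked by triangles through lower neighbours,
   because the lattice points of an open unit disc are connected by unit steps.
   Applying this to E(h) = class of h (x) v in the quotient of N by the relations
   gives f_v, and [a, b] (x) v |-> f_v(b) - f_v(a) is well defined on
   H_0(Gamma, St (x) V): antisymmetry and the cocycle relation are automatic, and
   linearity in v and Gamma-invariance follow from the uniqueness of f_v. It is a
   left inverse of the induced map. *)

From HB Require Import structures.
Require Import Defs.
From mathcomp Require Import all_boot all_order all_algebra.
From mathcomp Require Import boolp freeg.
From mathcomp Require Import ring zify.
Import Order.TTheory GRing.Theory Num.Theory.
Local Open Scope ring_scope.
Set Implicit Arguments.
Unset Strict Implicit.

(** * Gaussian integers *)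

Definition normG (x : gaussInt) : int := gre x ^+ 2 + gim x ^+ 2.
Definition gconj (x : gaussInt) : gaussInt := GaussInt (gre x) (- gim x).

Lemma gaussE x y : gre x = gre y -> gim x = gim y -> x = y.
Proof. by case: x y => [a b] [c d] /= -> ->. Qed.

Lemma greD x y : gre (x + y) = gre x + gre y. Proof. by []. Qed.
Lemma gimD x y : gim (x + y) = gim x + gim y. Proof. by []. Qed.
Lemma greN x : gre (- x) = - gre x. Proof. by []. Qed.
Lemma gimN x : gim (- x) = - gim x. Proof. by []. Qed.
Lemma greM x y : gre (x * y) = gre x * gre y - gim x * gim y.
Proof. by []. Qed.
Lemma gimM x y : gim (x * y) = gre x * gim y + gim x * gre y.
Proof. by []. Qed.
Definition gE := (greD, gimD, greN, gimN, greM, gimM).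

Lemma normGM x y : normG (x * y) = normG x * normG y.
Proof. by rewrite /normG !gE; ring. Qed.

Lemma normG1 : normG 1 = 1. Proof. by []. Qed.
Lemma normG0 : normG 0 = 0. Proof. by []. Qed.

Lemma normGN x : normG (- x) = normG x.
Proof. by rewrite /normG !gE; ring. Qed.

Lemma normG_ge0 x : 0 <= normG x.
Proof. by rewrite addr_ge0 ?sqr_ge0. Qed.

Lemma normG_eq0 x : (normG x == 0) = (x == 0).
Proof.
apply/eqP/eqP => [/eqP|->//].
by rewrite paddr_eq0 ?sqr_ge0 // !sqrf_eq0 => /andP[/eqP a /eqP b]; apply: gaussE.
Qed.

Lemma normG_gt0 x : (0 < normG x) = (x != 0).
Proof. by rewrite lt_def normG_eq0 normG_ge0 andbT. Qed.

Lemma gconjE x : normG x = 1 -> x * gconj x = 1.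
Proof.
by rewrite /normG => x1; apply: gaussE; rewrite !gE /=; [rewrite -[RHS]x1|]; ring.
Qed.

Lemma normG_unit x y : x * y = 1 -> normG x = 1.
Proof.
move=> /(congr1 normG); rewrite normGM normG1.
move: (normG x) (normG y) (normG_ge0 x) (normG_ge0 y) => m n m0 n0 mn.
have {}m0 : 1 <= m by nia.
have {}n0 : 1 <= n by nia.
nia.
Qed.

Lemma normG_conj x : normG (gconj x) = normG x.
Proof. by rewrite /normG /=; ring. Qed.

(** The units are the powers of [gi]; as [matJ] scales a column by [gi], invariance under [matJ]
    gives invariance under every unit. *)
Lemma gunitP x : normG x = 1 -> exists n, x = gi ^+ n.
Proof.
case: x => a b; rewrite /normG /= => x1.
have : (a = 1 /\ b = 0) \/ (a = 0 /\ b = 1) \/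
       (a = -1 /\ b = 0) \/ (a = 0 /\ b = -1).
  have : -1 <= a <= 1 by nia.
  have : -1 <= b <= 1 by nia.
  nia.
by case=> [|[|[]]] [-> ->]; [exists 0|exists 1|exists 2|exists 3].
Qed.

Lemma int_round (p m : int) : 0 < m ->
  exists t : int, - m <= 2 * (p - t * m) <= m.
Proof.
(* [t] is the floor of p/m + 1/2, an integer nearest to p/m. *)
move=> m0; exists ((2 * p + m) %/ (2 * m))%Z.
have d0 : 2 * m != 0 by lia.
have := ltz_pmod (2 * p + m) (d := 2 * m) ltac:(lia).
have := modz_ge0 (2 * p + m) d0; have := divz_eq (2 * p + m) (2 * m).
move: (_ %/ _)%Z (_ %% _)%Z => q r e r0 r1.
have -> : 2 * (p - q * m) = r - m by lia.
lia.
Qed.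

(** Round both coordinates of x/c = x conj(c)/|c|^2; the error has norm at most 1/2. *)
Lemma gauss_div x c : c != 0 -> exists q, normG (x - q * c) < normG c.
Proof.
move=> c0; have m0 : 0 < normG c by rewrite normG_gt0.
have [s hs] := int_round (gre (x * gconj c)) m0.
have [t ht] := int_round (gim (x * gconj c)) m0.
exists (GaussInt s t).
rewrite -(ltr_pM2r m0).
have -> : normG (x - GaussInt s t * c) * normG c =
    (gre (x * gconj c) - s * normG c) ^+ 2 +
    (gim (x * gconj c) - t * normG c) ^+ 2.
  by rewrite -[normG c in LHS]normG_conj -normGM /normG !gE /=; ring.
have sq (u m : int) : - m <= 2 * u <= m -> 4 * u ^+ 2 <= m ^+ 2.
  move=> /andP[u1 u2].
  have : 0 <= (m - 2 * u) * (m + 2 * u) by rewrite mulr_ge0 //; lia.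
  by rewrite !expr2; lia.
have {hs} := sq _ _ hs; have {ht} := sq _ _ ht.
have : 0 < normG c * normG c by rewrite mulr_gt0.
move: (_ - s * _) (_ - t * _) => u v; rewrite !expr2; lia.
Qed.

Lemma gauss_bezout a c : exists x y, gdvd (x * a + y * c) a /\
  gdvd (x * a + y * c) c.
Proof.
have [n] := ubnP `|normG c|%N; elim: n => // n IHn in a c *; move=> cn.
have [->|c0] := eqVneq c 0.
  by exists 1, 0; split; [exists 1|exists 0]; ring.
have [q qc] := gauss_div a c0.
have [|x [y [[u eu] [v ev]]]] := IHn c (a - q * c).
  move: cn qc (normG_ge0 c) (normG_ge0 (a - q * c)).
  by move: (normG c) (normG (a - _)) => s t; lia.
have e : y * a + (x - y * q) * c = x * c + y * (a - q * c) by ring.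
exists y, (x - y * q); rewrite e; split; last by exists u.
by exists (v + q * u); rewrite mulrDl -mulrA -eu -ev; ring.
Qed.

Lemma int_sqr_le1 (a : int) : a ^+ 2 < 4 -> a = -1 \/ a = 0 \/ a = 1.
Proof. by move=> lt; have : -1 <= a <= 1; [nia|lia]. Qed.

(** Inside the open disc |z|^2 < n, the lattice points d and ck + d are joined by at most two steps,
    each a unit times c: the real and imaginary parts of k, in a suitable order. *)
Lemma short_vector_split (c d k : gaussInt) n :
  n <= normG c -> normG d < n -> normG (c * k + d) < n ->
  exists k1 k2, [/\ k = k1 + k2, k1 = 0 \/ normG k1 = 1,
    k2 = 0 \/ normG k2 = 1 & normG (c * k1 + d) < n].
Proof.
move=> cn dn kn; case: k kn => a b kn.
(* Parallelogram law: |ck|^2 + |ck + 2d|^2 = 2|ck + d|^2 + 2|d|^2 < 4n <= 4|c|^2. *)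
have k4 : normG (GaussInt a b) < 4.
  have c0 : 0 < normG c by have := normG_ge0 d; lia.
  rewrite -(ltr_pM2l c0) -normGM.
  have := normG_ge0 (c * GaussInt a b + d + d).
  have : normG (c * GaussInt a b) + normG (c * GaussInt a b + d + d) =
      2 * normG (c * GaussInt a b + d) + 2 * normG d.
    by rewrite /normG !gE; ring.
  lia.
rewrite /normG /= in k4.
have a1 : a = -1 \/ a = 0 \/ a = 1.
  by apply: int_sqr_le1; apply: le_lt_trans k4; rewrite lerDl sqr_ge0.
have b1 : b = -1 \/ b = 0 \/ b = 1.
  by apply: int_sqr_le1; apply: le_lt_trans k4; rewrite lerDr sqr_ge0.
have u1 : GaussInt a 0 = 0 \/ normG (GaussInt a 0) = 1.
  by case: a1 => [|[]] ->; [right|left|right].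
have u2 : GaussInt 0 b = 0 \/ normG (GaussInt 0 b) = 1.
  by case: b1 => [|[]] ->; [right|left|right].
(* British flag theorem: when |k|^2 = 2, two opposite corners of the square
   lie in the open disc, hence so does a third one. *)
have /orP[lt|lt] : (normG (c * GaussInt a 0 + d) < n) ||
    (normG (c * GaussInt 0 b + d) < n).
- have : normG (c * GaussInt a 0 + d) + normG (c * GaussInt 0 b + d) =
      normG (c * GaussInt a b + d) + normG d.
    by rewrite /normG !gE /=; ring.
  lia.
- by exists (GaussInt a 0), (GaussInt 0 b); split=> //; apply: gaussE => /=; lia.
- by exists (GaussInt 0 b), (GaussInt a 0); split=> //; apply: gaussE => /=; lia.
Qed.

(** With z = d conj(c) and |k| = 1, |ck + d|^2 = 2|c|^2 + 2 Re(z conj(k)). As |z| = |c|^2, some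
    coordinate of z exceeds |c|^2/2 in absolute value, and k is the unit pointing against it. *)
Lemma unit_shift (c d : gaussInt) : 0 < normG c -> normG d = normG c ->
  exists k, normG k = 1 /\ normG (c * k + d) < normG c.
Proof.
move=> c0 dc; pose z := d * gconj c.
have E k : normG k = 1 ->
    normG (c * k + d) = 2 * normG c + 2 * (gre z * gre k + gim z * gim k).
  move=> k1; have -> : normG (c * k + d) = normG c * normG k + normG d +
      2 * (gre z * gre k + gim z * gim k).
    by rewrite /z /normG !gE /=; ring.
  by rewrite k1 dc; ring.
have zn : gre z ^+ 2 + gim z ^+ 2 = normG c ^+ 2.
  by rewrite -[LHS]/(normG z) normGM normG_conj dc expr2.
move: (normG c) (gre z) (gim z) c0 zn E => m p q m0 zn E {z dc}.
have : 2 * p < - m \/ m < 2 * p \/ 2 * q < - m \/ m < 2 * q.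
  have [?|p1] := ltP (2 * p) (- m); first by left.
  have [?|p2] := ltP m (2 * p); first by right; left.
  have [?|q1] := ltP (2 * q) (- m); first by right; right; left.
  have [?|q2] := ltP m (2 * q); first by right; right; right.
  have : 0 <= (m - 2 * p) * (m + 2 * p) by rewrite mulr_ge0 //; lia.
  have : 0 <= (m - 2 * q) * (m + 2 * q) by rewrite mulr_ge0 //; lia.
  have : 0 < m * m by rewrite mulr_gt0.
  by rewrite !expr2 in zn; lia.
case=> [h|[h|[h|h]]].
- by exists 1; split; rewrite // E //=; lia.
- by exists (-1); split; rewrite // E //=; lia.
- by exists gi; split; rewrite // E //=; lia.
- by exists (- gi); split; rewrite // E //=; lia.
Qed.

(** * Edges and cusps *)

Lemma ord2P (P : 'I_2 -> Prop) : P 0 -> P 1 -> forall i, P i.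
Proof.
move=> P0 P1 [[|[|i]] hi] //.
- by rewrite (_ : Ordinal hi = 0) //; apply: val_inj.
- by rewrite (_ : Ordinal hi = 1) //; apply: val_inj.
Qed.

Lemma GLP (h h' : GL2 gaussInt) :
  (forall i, h i 0 = h' i 0) -> (forall i, h i 1 = h' i 1) -> h = h'.
Proof.
move=> e0 e1; apply: uval_inj; apply/matrixP => i j.
by elim/ord2P: j.
Qed.

Lemma GLM (h g : GL2 gaussInt) i j :
  GLmx (h * g)%g i j = h i 0 * g 0 j + h i 1 * g 1 j.
Proof.
rewrite mxE !big_ord_recl big_ord0 addr0.
by rewrite (_ : fintype.lift ord0 ord0 = 1) //; apply: val_inj.
Qed.

Lemma mx2E (a b c d : gaussInt) :
  ((mx2 a b c d 0 0 = a) * (mx2 a b c d 0 1 = b) *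
   (mx2 a b c d 1 0 = c) * (mx2 a b c d 1 1 = d))%type.
Proof. by rewrite !mxE. Qed.

(** The adjugate divided by the determinant, whose inverse is its conjugate because its norm is
    1. *)
Lemma gl_subproof (a b c d : gaussInt) : normG (a * d - b * c) = 1 ->
  let x := gconj (a * d - b * c) in
  mx2 a b c d * mx2 (x * d) (- (x * b)) (- (x * c)) (x * a) = 1 /\
  mx2 (x * d) (- (x * b)) (- (x * c)) (x * a) * mx2 a b c d = 1.
Proof.
move=> /gconjE; set x := gconj _ => e /=; rewrite !mx2M -mx2_1.
by split; congr mx2; rewrite -?e; ring.
Qed.
Definition gl a b c d (e : normG (a * d - b * c) = 1) : GL2 gaussInt :=
  mkunit (proj1 (gl_subproof e)) (proj2 (gl_subproof e)).

Lemma gl_uvalE a b c d (e : normG (a * d - b * c) = 1) :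
  gl e = mx2 a b c d :> 'M_2.
Proof. by []. Qed.

Lemma normG_det (h : GL2 gaussInt) : normG (h 0 0 * h 1 1 - h 0 1 * h 1 0) = 1.
Proof.
have dM (g g' : GL2 gaussInt) : GLmx (g * g')%g 0 0 * GLmx (g * g')%g 1 1 -
    GLmx (g * g')%g 0 1 * GLmx (g * g')%g 1 0 =
    (g 0 0 * g 1 1 - g 0 1 * g 1 0) * (g' 0 0 * g' 1 1 - g' 0 1 * g' 1 0).
  by rewrite !GLM; ring.
have := dM h (h^-1)%g; rewrite mulgV => /esym e; apply: normG_unit (etrans e _).
by rewrite [GLmx 1%g](_ : _ = 1%:M) // !mxE.
Qed.

Lemma ucolP (v w : ucol) : (forall i, v i 0 = w i 0) -> v = w.
Proof.
move=> vw; apply: val_inj; apply/matrixP => i j.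
by rewrite [j](_ : j = 0) ?vw //; apply: ord1.
Qed.

(** Column 0 is the head h(oo) of the edge [h], column 1 its tail h(0). *)
Definition gcol (h : GL2 gaussInt) (j : 'I_2) : ucol :=
  umulv h (if j == 0 then ucoloo else ucol0).

Lemma gcolE (h : GL2 gaussInt) j i : gcol h j i 0 = h i j.
Proof. by rewrite /gcol; elim/ord2P: j => /=; rewrite -colE mxE. Qed.

Lemma gcolP (h h' : GL2 gaussInt) j j' :
  (forall i, h i j = h' i j') -> gcol h j = gcol h' j'.
Proof. by move=> e; apply: ucolP => i; rewrite !gcolE. Qed.

(** Right multiplication is a column operation. Describing auxiliary edges by their columns turns
    later checks into ring identities. *)
Lemma GL_mulcol (h : GL2 gaussInt) a b c d : normG (a * d - b * c) = 1 ->
  exists h' : GL2 gaussInt,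
    (forall i, h' i 0 = h i 0 * a + h i 1 * c) /\
    (forall i, h' i 1 = h i 0 * b + h i 1 * d).
Proof.
by move=> e; exists (h * gl e)%g; split=> i; rewrite GLM gl_uvalE !mx2E.
Qed.

(** [h^-1 * h'] fixes (1, 0)^T, so it is upper triangular with second column (k, u)^T, and u is a
    unit because the determinant is. *)
Lemma GL_same_col (h h' : GL2 gaussInt) : (forall i, h i 0 = h' i 0) ->
  exists k u, normG u = 1 /\ forall i, h' i 1 = h i 0 * k + h i 1 * u.
Proof.
move=> e0; pose g : GL2 gaussInt := (h^-1 * h')%g.
have hg : h' = (h * g)%g by rewrite mulVKg.
have goo : umulv g ucoloo = ucoloo.
  rewrite umulvM -[umulv h' _]/(gcol h' 0) -(gcolP e0) /gcol /=.
  by rewrite -umulvM mulVg umulv1.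
have g0 i : g i 0 = ucoloo i 0.
  by rewrite -[in RHS]goo -[RHS]/(gcol g 0 i 0) gcolE.
exists (g 0 1), (g 1 1); split; last by move=> i; rewrite hg GLM.
by rewrite -(normG_det g) !g0 !mxE /=; congr normG; ring.
Qed.

(** The column (a, c)^T is the cusp a/c; its height |c|^2 vanishes only on unit multiples of (1,
    0)^T. *)
Definition cusp_height (v : ucol) : int := normG (v 1 0).

Lemma cusp_height_ge0 v : 0 <= cusp_height v. Proof. exact: normG_ge0. Qed.

Lemma ucol_bezout (v : ucol) : exists x y, x * v 0 0 + y * v 1 0 = 1.
Proof.
have /asboolP vu := valP v.
have [x [y [da dc]]] := gauss_bezout (v 0 0) (v 1 0).
by have [e ee] := vu _ da dc; exists (e * x), (e * y); rewrite ee; ring.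
Qed.

(** If x a + y c = 1, then (y, -x)^T is a neighbour of (a, c)^T. Subtracting a multiple of (a, c)^T
    keeps the determinant and reduces -x modulo c. *)
Lemma lower_neighbour (v : ucol) : 0 < cusp_height v ->
  exists h, gcol h 0 = v /\ cusp_height (gcol h 1) < cusp_height v.
Proof.
rewrite /cusp_height normG_gt0 => c0.
have [x [y xy]] := ucol_bezout v; have [q qc] := gauss_div (- x) c0.
have dt : normG (v 0 0 * (- x - q * v 1 0) - (y - q * v 0 0) * v 1 0) = 1.
  have -> : v 0 0 * (- x - q * v 1 0) - (y - q * v 0 0) * v 1 0 =
      - (x * v 0 0 + y * v 1 0) by ring.
  by rewrite xy.
exists (gl dt); split; last by rewrite gcolE gl_uvalE mx2E.
apply: ucolP => i; rewrite gcolE gl_uvalE /=.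
by elim/ord2P: i; rewrite mx2E.
Qed.

Lemma cusp_height0 (v : ucol) : cusp_height v = 0 ->
  exists h, gcol h 0 = v /\ gcol h 1 = ucol0.
Proof.
rewrite /cusp_height => /eqP; rewrite normG_eq0 => /eqP c0.
have /asboolP vu := valP v; have [||e e1] := vu (v 0 0).
- by exists 1; rewrite mul1r.
- by exists 0; rewrite c0 mul0r.
have dt : normG (v 0 0 * 1 - 0 * 0) = 1.
  by apply: (@normG_unit _ e); rewrite [RHS]e1; ring.
exists (gl dt); split; apply: ucolP => i; rewrite gcolE gl_uvalE /=.
  by elim/ord2P: i; rewrite mx2E.
by elim/ord2P: i; rewrite mx2E !mxE.
Qed.

(** The descent read backwards: chains of edges from oo reach every cusp. Hence a function on cusps
    is determined by its value at oo and its increments along edges. *)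
Lemma cusp_ind (P : ucol -> Prop) : P ucoloo ->
  (forall h, P (umulv h ucol0) -> P (umulv h ucoloo)) -> forall v, P v.
Proof.
move=> Poo Pedge.
have P0 : P ucol0.
  (* The matrix (0 1; 1 0) is an edge from oo to 0. *)
  have w1 : normG (0 * 0 - 1 * 1) = 1 by [].
  have := Pedge (gl w1); rewrite -[umulv _ ucoloo]/(gcol _ 0).
  have -> : gcol (gl w1) 0 = ucol0.
    apply: ucolP => i; rewrite gcolE gl_uvalE.
    by elim/ord2P: i; rewrite mx2E !mxE.
  apply; rewrite (_ : umulv _ _ = ucoloo) //.
  apply: ucolP => i; rewrite -[umulv _ ucol0]/(gcol _ 1) gcolE gl_uvalE.
  by elim/ord2P: i; rewrite mx2E !mxE.
move=> v; have [n] := ubnP `|cusp_height v|%N; elim: n => // n IHn in v *.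
have := cusp_height_ge0 v; rewrite le0r => /orP[/eqP/cusp_height0[h [<- h0]] _|].
  by apply: Pedge; rewrite -[umulv _ _]/(gcol h 1) h0.
move=> /lower_neighbour[h [<- hlt]] hn; apply: Pedge; apply: IHn.
rewrite -[umulv _ _]/(gcol h 1); have := cusp_height_ge0 (gcol h 1).
by move: hlt hn; move: (cusp_height _) (cusp_height _) => s t; lia.
Qed.

(** * Potentials *)

Lemma matJ_uvalE : matJ = mx2 gi 0 0 1 :> 'M_2. Proof. by []. Qed.
Lemma matS_uvalE : matS = mx2 0 gi 1 0 :> 'M_2. Proof. by []. Qed.
Lemma matL_uvalE : matL = mx2 1 (-1) 1 0 :> 'M_2. Proof. by []. Qed.

Section ManinPotential.
Variables (U : zmodType) (E : GL2 gaussInt -> U).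
Hypothesis EJ : forall h, E (h * matJ)%g = E h.
Hypothesis ES : forall h, E (h * matS)%g = - E h.
Hypothesis EL : forall h, E h + E (h * matL)%g + E (h * matL * matL)%g = 0.

Lemma E_unitl (h h' : GL2 gaussInt) u : normG u = 1 ->
  (forall i, h' i 0 = h i 0 * u) -> (forall i, h' i 1 = h i 1) -> E h' = E h.
Proof.
case/gunitP=> n ->; elim: n => [|n IHn] in h *.
  by move=> e0 e1; congr E; apply: GLP => // i; rewrite e0 mulr1.
move=> e0 e1; rewrite -(EJ h); apply: IHn => i; rewrite GLM matJ_uvalE !mx2E.
  by rewrite e0 exprS; ring.
by rewrite e1; ring.
Qed.

(** [matS] exchanges the columns up to a unit, which reduces this to [E_unitl]. *)
Lemma E_unitr (h h' : GL2 gaussInt) u : normG u = 1 ->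
  (forall i, h' i 0 = h i 0) -> (forall i, h' i 1 = h i 1 * u) -> E h' = E h.
Proof.
move=> u1 e0 e1; apply: oppr_inj; rewrite -!ES.
by apply: (E_unitl u1) => i; rewrite !GLM matS_uvalE !mx2E ?e0 ?e1; ring.
Qed.

Lemma E_units (h h' : GL2 gaussInt) u w : normG u = 1 -> normG w = 1 ->
  (forall i, h' i 0 = h i 0 * u) -> (forall i, h' i 1 = h i 1 * w) ->
  E h' = E h.
Proof.
move=> u1 w1 e0 e1.
have [|d [d0 d1]] := @GL_mulcol h u 0 0 1; first by rewrite mulr1 mulr0 subr0.
rewrite -(@E_unitl h d u) //; first apply: (E_unitr w1) => i.
- by rewrite d0 e0; ring.
- by rewrite d1 e1; ring.
- by move=> i; rewrite d0; ring.
- by move=> i; rewrite d1; ring.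
Qed.

Lemma E_swap (h h' : GL2 gaussInt) u w : normG u = 1 -> normG w = 1 ->
  (forall i, h' i 0 = h i 1 * u) -> (forall i, h' i 1 = h i 0 * w) ->
  E h' = - E h.
Proof.
move=> u1 w1 e0 e1; rewrite -ES.
(* The factor [- gi] cancels the [gi] that [matS] puts on the second column. *)
apply: (@E_units _ _ u (w * - gi)) => //; first by rewrite normGM w1.
  by move=> i; rewrite GLM matS_uvalE !mx2E e0; ring.
move=> i; rewrite GLM matS_uvalE !mx2E e1 -[LHS]mulr1 -(opprK 1) -giM; ring.
Qed.

(* Here h = d * diag(k, u)^-1, where d, d * matL, d * matL ^+ 2 run around the
   triangle whose oriented edges are h, - h1 and - h2. *)
Lemma E_triangle (h h1 h2 : GL2 gaussInt) k u : normG k = 1 -> normG u = 1 ->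
  (forall i, h1 i 0 = h i 0) -> (forall i, h1 i 1 = h i 0 * k + h i 1 * u) ->
  (forall i, h2 i 0 = h1 i 1) -> (forall i, h2 i 1 = h i 1) ->
  E h = E h1 + E h2.
Proof.
move=> k1 u1 e0 e1 f0 f1.
have [|d [d0 d1]] := @GL_mulcol h k 0 0 u.
  by rewrite mulr0 subr0 normGM k1 u1.
have := EL d; rewrite (@E_units h d k u) //; last 2 first.
- by move=> i; rewrite d0; ring.
- by move=> i; rewrite d1; ring.
rewrite (@E_swap h1 (d * matL)%g 1 (- k)) ?normGN //; last 2 first.
- by move=> i; rewrite GLM matL_uvalE !mx2E d0 d1 e1; ring.
- by move=> i; rewrite GLM matL_uvalE !mx2E d0 d1 e0; ring.
rewrite (@E_swap h2 (d * matL * matL)%g u (- 1)) ?normGN //; last 2 first.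
- by move=> i; rewrite !GLM matL_uvalE !mx2E d0 d1 f1; ring.
- by move=> i; rewrite !GLM matL_uvalE !mx2E d0 d1 f0 e1; ring.
by move/eqP; rewrite -addrA -opprD subr_eq0 => /eqP.
Qed.

(** An arbitrary choice of edge into [v] from a lower cusp. The default [1%g] occurs only at height
    0, where [descent] stops. *)
Definition lower_edge (v : ucol) : GL2 gaussInt :=
  if pselect (exists h, gcol h 0 = v /\
    cusp_height (gcol h 1) < cusp_height v) is left p
  then projT1 (cid p) else 1%g.

Lemma lower_edgeP v : 0 < cusp_height v -> gcol (lower_edge v) 0 = v /\
  cusp_height (gcol (lower_edge v) 1) < cusp_height v.
Proof.
move=> /lower_neighbour ex; rewrite /lower_edge.
by case: pselect => // p; case: (cid p).
Qed.

(* n is fuel: any n > cusp_height v gives the same value (descent_stable). *)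
Fixpoint descent n v : U :=
  if n is n'.+1 then
    if cusp_height v == 0 then 0
    else descent n' (gcol (lower_edge v) 1) + E (lower_edge v)
  else 0.

Definition potential v := descent `|cusp_height v|%N.+1 v.

(** Heights are natural numbers dropping strictly along [lower_edge], so fuel above the height never
    runs out. *)
Lemma descent_stable n v : cusp_height v < n%:Z -> descent n v = potential v.
Proof.
rewrite /potential.
have [m] := ubnP `|cusp_height v|%N; elim: m n v => // m IHm [|n] v; first last.
  move=> hm hn /=; case: eqP => // /eqP v0.
  have /lower_edgeP[_ lt] : 0 < cusp_height v by rewrite lt_def v0 cusp_height_ge0.
  move: (cusp_height_ge0 (gcol (lower_edge v) 1)) lt => ge0 lt; congr (_ + _).
  rewrite IHm; first last.
  - by move: hm hn ge0 lt; move: (cusp_height v) (cusp_height _) => s t; lia.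
  - by move: hm hn ge0 lt; move: (cusp_height v) (cusp_height _) => s t; lia.
  case e : `|cusp_height v|%N => [|p].
    by move: e v0; move: (cusp_height v) => s; lia.
  rewrite IHm //.
  - by move: hm hn ge0 lt e; move: (cusp_height v) (cusp_height _) => s t; lia.
  - by move: hm hn ge0 lt e; move: (cusp_height v) (cusp_height _) => s t; lia.
by move=> _; have := cusp_height_ge0 v; move: (cusp_height v) => s; lia.
Qed.

Lemma potential0 v : cusp_height v = 0 -> potential v = 0.
Proof. by rewrite /potential /= => ->. Qed.

Lemma potential_lower v : 0 < cusp_height v ->
  potential v = potential (gcol (lower_edge v) 1) + E (lower_edge v).
Proof.
move=> v0; rewrite {1}/potential /= gt_eqF //; congr (_ + _).
apply: descent_stable; have [_] := lower_edgeP v0.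
have := cusp_height_ge0 (gcol (lower_edge v) 1).
by move: (cusp_height v) (cusp_height _) => s t; lia.
Qed.

Let edge_ok (h : GL2 gaussInt) :=
  potential (gcol h 0) = potential (gcol h 1) + E h.

(** * Independence of the chosen lower neighbour *)

Section Step.
Variable n : int.
Hypothesis IHedge : forall h,
  cusp_height (gcol h 0) < n -> cusp_height (gcol h 1) < n -> edge_ok h.
Hypothesis IHunit : forall (v w : ucol) u, normG u = 1 -> cusp_height v < n ->
  (forall i, w i 0 = v i 0 * u) -> potential w = potential v.

(** For a unit k, the two tails and the common head form a triangle whose third side [d] lies below
    height n, where [IHedge] applies. For k = 0 the tails agree up to a unit. *)
Lemma adjacent_neighbours (h h' : GL2 gaussInt) k u : k = 0 \/ normG k = 1 ->
  normG u = 1 -> (forall i, h' i 0 = h i 0) ->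
  (forall i, h' i 1 = h i 0 * k + h i 1 * u) ->
  cusp_height (gcol h 1) < n -> cusp_height (gcol h' 1) < n ->
  potential (gcol h 1) + E h = potential (gcol h' 1) + E h'.
Proof.
move=> [->|k1] u1 e0 e1 lt lt'.
  rewrite (@IHunit (gcol h 1) (gcol h' 1) u) //; last first.
    by move=> i; rewrite !gcolE e1 mulr0 add0r.
  by rewrite (E_unitr u1 e0) // => i; rewrite e1; ring.
have [|d [d0 d1]] := @GL_mulcol h k 0 u 1; first by rewrite mulr1 mul0r subr0.
have d0E : gcol d 0 = gcol h' 1 by apply: gcolP => i; rewrite d0 e1.
have d1E : gcol d 1 = gcol h 1 by apply: gcolP => i; rewrite d1; ring.
have := @IHedge d; rewrite /edge_ok d0E d1E => ->//.
rewrite -addrA; congr (_ + _); rewrite addrC; apply: (E_triangle k1 u1 e0 e1).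
  by move=> i; rewrite d0 e1.
by move=> i; rewrite d1; ring.
Qed.

(* Two such h, h' have second columns differing by k times the first, up to a
   unit, with |k|^2 < 4; for |k|^2 = 2 one detours through a third neighbour. *)
Lemma lower_neighbours (h h' : GL2 gaussInt) :
  (forall i, h' i 0 = h i 0) -> n <= cusp_height (gcol h 0) ->
  cusp_height (gcol h 1) < n -> cusp_height (gcol h' 1) < n ->
  potential (gcol h 1) + E h = potential (gcol h' 1) + E h'.
Proof.
move=> e0 hn lt lt'; have [k [u [u1 e1]]] := GL_same_col (fun i => esym (e0 i)).
have via k1 k2 : k = k1 + k2 -> k1 = 0 \/ normG k1 = 1 ->
    k2 = 0 \/ normG k2 = 1 -> normG (h 1 0 * k1 + h 1 1 * u) < n ->
    potential (gcol h 1) + E h = potential (gcol h' 1) + E h'.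
  move=> kE k1u k2u ltk.
  have [|d [d0 d1]] := @GL_mulcol h 1 k1 0 u; first by rewrite mul1r mulr0 subr0.
  have ltd : cusp_height (gcol d 1) < n by rewrite /cusp_height gcolE d1.
  transitivity (potential (gcol d 1) + E d).
    apply: adjacent_neighbours k1u u1 _ d1 lt ltd => i; rewrite d0; ring.
  apply: (@adjacent_neighbours _ _ k2 1) => // i; first by rewrite d0 e0; ring.
  by rewrite d0 d1 e1 kE; ring.
have [||| k1 [k2 [kE k1u k2u ltk]]] :=
    @short_vector_split (h 1 0) (h 1 1 * u) k n; last exact: (via k1 k2).
- by rewrite -gcolE.
- by rewrite normGM u1 mulr1 -gcolE.
- by rewrite -e1 -gcolE.
Qed.

End Step.

(** The two claims need a joint induction: comparing lower neighbours uses unit invariance below n,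
    and unit invariance at height n uses the edge formula there. *)
Lemma potential_edge_lt (n : nat) :
  (forall h, cusp_height (gcol h 0) < n%:Z -> cusp_height (gcol h 1) < n%:Z ->
    edge_ok h) /\
  (forall (v w : ucol) u, normG u = 1 -> cusp_height v < n%:Z ->
    (forall i, w i 0 = v i 0 * u) -> potential w = potential v).
Proof.
elim: n => [|n [IHedge IHunit]].
  by split=> [h|v w u _]; rewrite ltNge cusp_height_ge0.
(* Compare [h] with the edge [lower_edge] that defines the potential of its head. *)
have lower h : cusp_height (gcol h 0) = n%:Z ->
    cusp_height (gcol h 1) < n%:Z -> edge_ok h.
  move=> hn lt; rewrite /edge_ok.
  have v0 : 0 < cusp_height (gcol h 0).
    by rewrite hn (le_lt_trans _ lt) ?cusp_height_ge0.
  have [e lt'] := lower_edgeP v0; rewrite (potential_lower v0).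
  apply: (lower_neighbours IHedge IHunit) => //.
  - by move=> i; rewrite -!gcolE e.
  - by rewrite e hn.
  - by rewrite -hn.
split=> [h|v w u u1].
  have le_lt m : (m < n.+1%:Z) = (m == n%:Z) || (m < n%:Z) by lia.
  rewrite !le_lt => /orP[/eqP h0|h0] /orP[/eqP h1|h1].
  (* Both ends have height n: [unit_shift] yields a common lower neighbour. The edges [d] and [g]
     run from it to the head and the tail of [h], and [f] is [g] reversed. *)
  - have dc : normG (h 1 1) = normG (h 1 0).
      by rewrite -!gcolE; exact: etrans h1 (esym h0).
    have c_gt0 : 0 < normG (h 1 0).
      rewrite normG_gt0; apply/eqP => c0; have := normG_det h.
      move/eqP: dc; rewrite c0 normG0 normG_eq0 => /eqP ->.
      by rewrite !mulr0 subr0.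
    have [k [k1 ltk]] := @unit_shift (h 1 0) (h 1 1) c_gt0 dc.
    have c_eq : normG (h 1 0) = n%:Z by rewrite -gcolE; exact: h0.
    rewrite c_eq in ltk.
    have [|d [d0 d1]] := @GL_mulcol h 1 k 0 1.
      by rewrite mul1r mulr0 subr0.
    have d0E : gcol d 0 = gcol h 0 by apply: gcolP => i; rewrite d0; ring.
    have ltd : cusp_height (gcol d 1) < n%:Z by rewrite /cusp_height gcolE d1 mulr1.
    have [|g [g0 g1]] := @GL_mulcol h 0 k 1 1.
      by rewrite mul0r sub0r mulr1 normGN.
    have g0E : gcol g 0 = gcol h 1 by apply: gcolP => i; rewrite g0; ring.
    have g1E : gcol g 1 = gcol d 1 by apply: gcolP => i; rewrite g1 d1.
    have [|f [f0 f1]] := @GL_mulcol h k 0 1 1; first by rewrite mul0r subr0 mulr1.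
    have := lower d; have := lower g; rewrite /edge_ok d0E g0E g1E h0 h1.
    move=> /(_ erefl ltd) -> /(_ erefl ltd) ->; rewrite -addrA; congr (_ + _).
    rewrite (@E_triangle h d f k 1) //.
    + rewrite addrCA (@E_swap f g 1 1) ?addNr ?addr0 // => i.
      * by rewrite g0 f1; ring.
      * by rewrite g1 f0; ring.
    + by move=> i; rewrite d0; ring.
    + by move=> i; rewrite f0 d1.
    + by move=> i; rewrite f1; ring.
  - exact: lower.
  (* Only the tail has height n: reverse the edge. *)
  - have [|d [d0 d1]] := @GL_mulcol h 0 1 1 0.
      by rewrite mul0r sub0r mulr1.
    have d0E : gcol d 0 = gcol h 1 by apply: gcolP => i; rewrite d0; ring.
    have d1E : gcol d 1 = gcol h 0 by apply: gcolP => i; rewrite d1; ring.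
    have := lower d; rewrite /edge_ok d0E d1E h1 => /(_ erefl h0) ->.
    rewrite (@E_swap h d 1 1) ?addrNK // => i; first by rewrite d0; ring.
    by rewrite d1; ring.
  - exact: IHedge.
(* Both potentials vanish at height 0. Otherwise, scaling the first column of [lower_edge v] by u
   gives an edge into w with the same tail and the same value of E. *)
move=> vn wv; have [v0|v0] := eqVneq (cusp_height v) 0.
  rewrite !potential0 //; move: v0; rewrite /cusp_height wv normGM => ->.
  by rewrite mul0r.
have {}v0 : 0 < cusp_height v by rewrite lt_def v0 cusp_height_ge0.
have [e lt] := lower_edgeP v0.
have [|d [d0 d1]] := @GL_mulcol (lower_edge v) u 0 0 1.
  by rewrite mulr1 mulr0 subr0.
have ve i : v i 0 = lower_edge v i 0 by rewrite -[in LHS]e gcolE.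
have d0E : gcol d 0 = w by apply: ucolP => i; rewrite gcolE wv d0 ve; ring.
have d1E : gcol d 1 = gcol (lower_edge v) 1.
  by apply: gcolP => i; rewrite d1; ring.
have wvn : cusp_height w = cusp_height v.
  by rewrite /cusp_height wv normGM u1 mulr1.
have : edge_ok d.
  have : cusp_height v = n%:Z \/ cusp_height v < n%:Z by lia.
  case=> [ev|lv]; [apply: lower|apply: IHedge]; rewrite ?d0E ?d1E ?wvn //.
    by rewrite -ev.
  exact: lt_trans lv.
rewrite /edge_ok d0E d1E => ->; rewrite (potential_lower v0); congr (_ + _).
by apply: (E_unitl u1) => i; rewrite ?d0 ?d1; ring.
Qed.

Lemma potential_edge h :
  potential (umulv h ucoloo) = potential (umulv h ucol0) + E h.
Proof.
pose m := maxn `|cusp_height (gcol h 0)| `|cusp_height (gcol h 1)|.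
have [ok _] := potential_edge_lt m.+1; apply: ok.
- have := leq_maxl `|cusp_height (gcol h 0)| `|cusp_height (gcol h 1)|.
  by rewrite -/m; have := cusp_height_ge0 (gcol h 0); lia.
- have := leq_maxr `|cusp_height (gcol h 0)| `|cusp_height (gcol h 1)|.
  by rewrite -/m; have := cusp_height_ge0 (gcol h 1); lia.
Qed.

End ManinPotential.

(** The value 0 at oo is the normalization that makes [f] unique, by [cusp_ind]. *)
Lemma manin_potential (U : zmodType) (E : GL2 gaussInt -> U) :
  (forall h, E (h * matJ)%g = E h) -> (forall h, E (h * matS)%g = - E h) ->
  (forall h, E h + E (h * matL)%g + E (h * matL * matL)%g = 0) ->
  exists f : ucol -> U, f ucoloo = 0 /\
    forall h, f (umulv h ucoloo) = f (umulv h ucol0) + E h.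
Proof.
move=> EJ ES EL; exists (potential E); split; last exact: potential_edge.
by apply: potential0; rewrite /cusp_height !mxE.
Qed.

(** * The Steinberg module *)

Lemma edge_from (v : ucol) : exists h, gcol h 0 = v.
Proof.
have := cusp_height_ge0 v; rewrite le0r => /orP[/eqP/cusp_height0|/lower_neighbour].
  by case=> h [<- _]; exists h.
by case=> h [<- _]; exists h.
Qed.

Lemma det_ucol (v w : ucol) :
  \det (@row_mx gaussInt 2 1 1 v w) = v 0 0 * w 1 0 - w 0 0 * v 1 0.
Proof.
have lE i : @row_mx gaussInt 2 1 1 v w i 0 = v i 0.
  by rewrite -(row_mxEl v w i 0); congr (row_mx _ _ _ _); apply: val_inj.
have rE i : @row_mx gaussInt 2 1 1 v w i 1 = w i 0.
  by rewrite -(row_mxEr v w i 0); congr (row_mx _ _ _ _); apply: val_inj.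
have det2 (A : 'M[gaussInt]_2) : \det A = A 0 0 * A 1 1 - A 0 1 * A 1 0.
  have l0 : fintype.lift 0 0 = 1 :> 'I_2 by apply: val_inj.
  have l1 : fintype.lift 1 0 = 0 :> 'I_2 by apply: val_inj.
  rewrite (expand_det_row _ 0) !big_ord_recl big_ord0 /cofactor !det_mx11 !mxE.
  rewrite [ord0](_ : _ = 0) // !l0 !l1 /=; ring.
by rewrite det2 !lE !rE.
Qed.

(** For x v_0 + y v_1 = 1, the vanishing determinant gives w = u v with u = x w_0 + y w_1. Then u
    divides both entries of the unimodular w, so it is a unit. *)
Lemma ucol_degenerate (v w : ucol) : \det (@row_mx gaussInt 2 1 1 v w) = 0 ->
  exists u, normG u = 1 /\ forall i, w i 0 = v i 0 * u.
Proof.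
rewrite det_ucol => /eqP; rewrite subr_eq0 => /eqP d0.
have [x [y xy]] := ucol_bezout v; exists (x * w 0 0 + y * w 1 0).
have wE i : w i 0 = v i 0 * (x * w 0 0 + y * w 1 0).
  elim/ord2P: i.
    rewrite mulrDr [v 0 0 * (y * _)]mulrCA d0 -[LHS]mul1r -{1}xy; ring.
  rewrite mulrDr [v 1 0 * (x * _)]mulrCA [v 1 0 * w 0 0]mulrC -d0.
  rewrite -[LHS]mul1r -{1}xy; ring.
split=> //; have /asboolP wu := valP w.
have [||e e1] := wu (x * w 0 0 + y * w 1 0).
- by exists (v 0 0); apply: wE.
- by exists (v 1 0); apply: wE.
by apply: (@normG_unit _ e); rewrite mulrC -e1.
Qed.

(** Scaling the first column of an edge into v gives an edge into w with the same tail and the same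
    value of E. *)
Lemma potential_degenerate (U : zmodType) (E : GL2 gaussInt -> U)
    (f : ucol -> U) (v w : ucol) :
  (forall h, E (h * matJ)%g = E h) ->
  (forall h, f (umulv h ucoloo) = f (umulv h ucol0) + E h) ->
  \det (@row_mx gaussInt 2 1 1 v w) = 0 -> f v = f w.
Proof.
move=> EJ fE /ucol_degenerate[u [u1 wv]]; have [h hv] := edge_from v.
have [|d [d0 d1]] := @GL_mulcol h u 0 0 1; first by rewrite mulr1 mulr0 subr0.
have dw : gcol d 0 = w.
  by apply: ucolP => i; rewrite wv gcolE d0 -hv gcolE; ring.
have dh : gcol d 1 = gcol h 1 by apply: gcolP => i; rewrite d1; ring.
rewrite -hv -dw [LHS]fE [RHS]fE -[umulv d _]/(gcol d 1) dh; congr (_ + _).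
by symmetry; apply: (E_unitl EJ u1) => i; rewrite (d0, d1); ring.
Qed.

Section LinearQuotient.
Variables (R : nzRingType) (V : lmodType R) (S : V -> Prop).

Lemma lpi_eq0 v : lpi S v = 0 -> v \in lspan S.
Proof.
move=> v0; have := lrepr_lpi S 0; rewrite linear0 -v0 subr0 => rS.
by rewrite -[v](subKr (lrepr (lpi S v))) rpredB // lrepr_lpi.
Qed.

End LinearQuotient.

Lemma lspan_sub (R : nzRingType) (V : lmodType R) (P : submodClosed V) v :
  v \in lspan (fun w => w \in P) -> v \in P.
Proof.
move=> /asboolP[s [sP ->]]; rewrite big_seq; apply: rpred_sum => x xs.
exact/rpredZ/sP.
Qed.

Lemma indcoinv_ext (R : comNzRingType) (G : groupType) (Gam : {pred G})
    (V U : lmodType R) (rho : linrep G V) (f g : {linear indcoinv Gam rho -> U}) :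
  (forall h v, f (pindcoinv Gam rho h v) = g (pindcoinv Gam rho h v)) -> f =1 g.
Proof.
move=> fg; elim/lquotP => x.
apply: (@tens_ext _ _ _ _ (f \o coinv_pi _ _) (g \o coinv_pi _ _)) => s v /=.
elim/freeg_lin_ind: s => [|c h s IH].
  by rewrite -(scale0r 0) ptensZl !scale0r !linear0.
by rewrite ptensDl ptensZl !linearP IH; congr (_ *: _ + _); apply: fg.
Qed.

(** * Descending cusp functions to H_0(Gamma, St (x) V) *)

Section CuspFunction.
Variables (R : comNzRingType) (Gam : {pred GL2 gaussInt}) (V : lmodType R).
Variable rho : linrep (GL2 gaussInt) V.
Variables (Q : lmodType R) (q : {linear indcoinv Gam rho -> Q}).
Variable F : V -> ucol -> Q.
Let e h v := q (pindcoinv Gam rho h v).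
Hypothesis eJ : forall h v, e (h * matJ)%g v = e h v.
Hypothesis Foo : forall v, F v ucoloo = 0.
Hypothesis Fedge : forall v h,
  F v (umulv h ucoloo) = F v (umulv h ucol0) + e h v.

(** Both sides vanish at oo and have the same increments along edges. *)
Lemma cuspfunD v w a : F (v + w) a = F v a + F w a.
Proof.
elim/cusp_ind: a => [|h IH]; first by rewrite !Foo addr0.
rewrite !Fedge IH addrACA; congr (_ + _).
by rewrite /e /pindcoinv ptensDr !linearD.
Qed.

Lemma cuspfunZ c v a : F (c *: v) a = c *: F v a.
Proof.
elim/cusp_ind: a => [|h IH]; first by rewrite !Foo scaler0.
rewrite !Fedge IH scalerDr; congr (_ + _).
by rewrite /e /pindcoinv ptensZr !linearZ.
Qed.

Lemma pindcoinv_act g h v : g \in Gam ->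
  pindcoinv Gam rho (g * h)%g (rho g v) = pindcoinv Gam rho h v.
Proof.
move=> gG; apply: lpi_eq; apply: mem_lspan.
have -> : ptens << (g * h)%g >> (rho g v) =
    tens_rep (reg_rep R (GL2 gaussInt)) rho g (ptens << h >> v).
  by rewrite /= tens_mapE /= freeg_mapE.
exact: CoinvRel.
Qed.

(** Since gh (x) gv = h (x) v in the coinvariants, both sides have the same increments in a; the
    constant corrects the value at oo. *)
Lemma cuspfun_act g v a : g \in Gam ->
  F (rho g v) (umulv g a) = F v a + F (rho g v) (umulv g ucoloo).
Proof.
move=> gG; elim/cusp_ind: a => [|h IH]; first by rewrite Foo add0r.
by rewrite -umulvM [LHS]Fedge umulvM IH (Fedge v h) /e pindcoinv_act // addrAC.
Qed.

Let st_pre v : {linear {freeg (ucol * ucol)%type / R} -> Q} :=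
  fglift (fun x : (ucol * ucol)%type => F v x.2 - F v x.1).

Lemma st_pre0 v x : st_rel x -> st_pre v x = 0.
Proof.
case=> [a b|a b ab|a b c]; rewrite ?linearD ?linearN /= !extendE /=.
- by rewrite addrC subrKA subrr.
- by rewrite (potential_degenerate (eJ^~ v) (Fedge v) ab) subrr.
- by rewrite !opprB !addrA !subrK subrr.
Qed.

Definition st_lift v : steinberg R -> Q := descend (st_pre0 v).
HB.instance Definition _ v := GRing.Linear.on (st_lift v).

Lemma st_liftE v a b : st_lift v (st_sym R a b) = F v b - F v a.
Proof. by rewrite [LHS]descendE [LHS]extendE. Qed.

Lemma st_liftD v w s : st_lift (v + w) s = st_lift v s + st_lift w s.
Proof.
apply: (@lquot_free_ext _ _ _ _ (st_lift (v + w)) (st_lift v \+ st_lift w)).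
by case=> a b /=; rewrite !st_liftE !cuspfunD opprD addrACA.
Qed.

Lemma st_liftZ c v s : st_lift (c *: v) s = c *: st_lift v s.
Proof.
apply: (@lquot_free_ext _ _ _ _ (st_lift (c *: v)) (c \*: st_lift v)).
by case=> a b /=; rewrite !st_liftE !cuspfunZ scalerBr.
Qed.

Let tens_pre : {linear {freeg (steinberg R * V)%type / R} -> Q} :=
  fglift (fun x : (steinberg R * V)%type => st_lift x.2 x.1).

Lemma tens_pre0 x : tens_rel x -> tens_pre x = 0.
Proof.
case=> [s t v|s v w|c s v|c s v];
  rewrite !linearB ?linearZ /= !extendE /= ?scalerN.
- by rewrite linearD -addrA -opprD subrr.
- by rewrite st_liftD -addrA -opprD subrr.
- by rewrite linearZ subrr.
- by rewrite st_liftZ subrr.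
Qed.

Definition tens_lift : tens (steinberg R) V -> Q := descend tens_pre0.
HB.instance Definition _ := GRing.Linear.on tens_lift.

Lemma tens_liftE s v : tens_lift (ptens s v) = st_lift v s.
Proof. by rewrite [LHS]descendE [LHS]extendE. Qed.

Lemma tens_lift_act g x : g \in Gam ->
  tens_lift (tens_rep (st_rep R) rho g x) = tens_lift x.
Proof.
move=> gG; apply: (@tens_ext _ _ _ _
  (tens_lift \o tens_rep (st_rep R) rho g) tens_lift) => s v /=.
rewrite tens_mapE !tens_liftE.
apply: (@lquot_free_ext _ _ _ _ (st_lift (rho g v) \o st_rep R g) (st_lift v)).
move=> [a b] /=; rewrite [st_act _ _]st_actE !st_liftE.
(* The constant of [cuspfun_act] cancels in the difference. *)
by rewrite (cuspfun_act _ a gG) (cuspfun_act _ b gG) opprD addrACA subrr addr0.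
Qed.

Lemma coinv_pre0 x : coinv_rel Gam (tens_rep (st_rep R) rho) x ->
  tens_lift x = 0.
Proof. by case=> g v gG; rewrite linearB /= tens_lift_act ?subrr. Qed.

Definition coinv_lift : st_coinv Gam rho -> Q := descend coinv_pre0.
HB.instance Definition _ := GRing.Linear.on coinv_lift.

(** On [h(0), h(oo)] (x) v the lift is F_v(h(oo)) - F_v(h(0)), the increment along h. Thus [q]
    factors through the induced map. *)
Lemma coinv_liftE x : coinv_lift (indcoinv_to_st Gam rho x) = q x.
Proof.
apply: (@indcoinv_ext _ _ _ _ _ _ (coinv_lift \o indcoinv_to_st Gam rho) q).
move=> h v /=; rewrite indcoinv_to_stE [LHS](descendE coinv_pre0).
by rewrite [LHS]tens_liftE st_liftE Fedge addrC addKr.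
Qed.

End CuspFunction.

Lemma mem_submod_suml (R : nzRingType) (V : lmodType R) (P Q : submodClosed V) v :
  v \in P -> v \in submod_sum P Q.
Proof.
by move=> vP; apply/asboolP; exists v => //; exists 0; rewrite ?rpred0 ?addr0.
Qed.

Lemma mem_submod_sumr (R : nzRingType) (V : lmodType R) (P Q : submodClosed V) v :
  v \in Q -> v \in submod_sum P Q.
Proof.
by move=> vQ; apply/asboolP; exists 0; rewrite ?rpred0 //; exists v; rewrite ?add0r.
Qed.

(** * The three relations in the Steinberg module *)

Section SteinbergSymbols.
Variable R : comNzRingType.

Lemma st_cocycle a b c : st_sym R a c = st_sym R a b + st_sym R b c.
Proof.
rewrite -linearD; apply: lpi_eq; rewrite opprD addrA.
exact/mem_lspan/StCocycle.
Qed.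

Lemma st_proportional (v w : ucol) u : (forall i, w i 0 = v i 0 * u) ->
  st_sym R v w = 0.
Proof.
move=> wv; rewrite -[RHS](linear0 (lpi (@st_rel R))); apply: lpi_eq.
by rewrite subr0; apply/mem_lspan/StDegen; rewrite det_ucol !wv; ring.
Qed.

Lemma st_self v : st_sym R v v = 0.
Proof. by apply: (@st_proportional v v 1) => i; rewrite mulr1. Qed.

Lemma st_matJ h : st_sym R (gcol (h * matJ)%g 1) (gcol (h * matJ)%g 0) =
  st_sym R (gcol h 1) (gcol h 0).
Proof.
rewrite (st_cocycle _ (gcol h 0)) (@st_proportional (gcol h 0) _ gi) ?addr0.
  by congr st_sym; apply: gcolP => i; rewrite GLM matJ_uvalE !mx2E; ring.
by move=> i; rewrite !gcolE GLM matJ_uvalE !mx2E; ring.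
Qed.

Lemma st_matS h : st_sym R (gcol (h * matS)%g 1) (gcol (h * matS)%g 0) =
  - st_sym R (gcol h 1) (gcol h 0).
Proof.
apply/eqP; rewrite -addr_eq0.
have -> : gcol (h * matS)%g 0 = gcol h 1.
  by apply: gcolP => i; rewrite GLM matS_uvalE !mx2E; ring.
rewrite -st_cocycle (@st_proportional _ _ (- gi)) // => i.
rewrite !gcolE GLM matS_uvalE !mx2E -[LHS]mulr1 -(opprK 1) -giM; ring.
Qed.

(** Up to sign, each tail is the preceding head and the last head is the first tail, so the sum
    telescopes around a closed triangle. *)
Lemma st_matL h : st_sym R (gcol h 1) (gcol h 0) +
  st_sym R (gcol (h * matL)%g 1) (gcol (h * matL)%g 0) +
  st_sym R (gcol (h * matL * matL)%g 1) (gcol (h * matL * matL)%g 0) = 0.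
Proof.
have -> : gcol (h * matL * matL)%g 0 = gcol h 1.
  by apply: gcolP => i; rewrite !GLM matL_uvalE !mx2E; ring.
have L1 (g : GL2 gaussInt) w :
    st_sym R (gcol (g * matL)%g 1) w =
    st_sym R (gcol g 0) w.
  rewrite (st_cocycle _ (gcol g 0)) (@st_proportional _ _ (-1)) ?add0r // => i.
  by rewrite !gcolE GLM matL_uvalE !mx2E; ring.
by rewrite !L1 -!st_cocycle st_self.
Qed.

End SteinbergSymbols.

(** * Exactness of the presentation *)

Section Presentation.
Variables (R : comNzRingType) (Gam : {pred GL2 gaussInt}) (V : lmodType R).
Variable rho : linrep (GL2 gaussInt) V.
Let N (x : {freeg (GL2 gaussInt) / R}) := rmul_img Gam rho x.
Let T := submod_sum
  (submod_sum (N (<< 1%g >> - << matJ >>)) (N (<< 1%g >> + << matS >>)))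
  (N (<< 1%g >> + << matL >> + << (matL * matL)%g >>)).
Let pind := pindcoinv Gam rho.

Lemma rmul_JE h v :
  rmul (<< 1%g >> - << matJ >>) (pind h v) = pind h v - pind (h * matJ)%g v.
Proof. by rewrite /rmul linearB /= !extendE !rmulgE mulg1. Qed.

Lemma rmul_SE h v :
  rmul (<< 1%g >> + << matS >>) (pind h v) = pind h v + pind (h * matS)%g v.
Proof. by rewrite /rmul linearD /= !extendE !rmulgE mulg1. Qed.

Lemma rmul_LE h v :
  rmul (<< 1%g >> + << matL >> + << (matL * matL)%g >>) (pind h v) =
  pind h v + pind (h * matL)%g v + pind (h * matL * matL)%g v.
Proof. by rewrite /rmul !linearD /= !extendE !rmulgE mulg1 mulgA. Qed.

Lemma indcoinv_to_st_rmul x :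
  (forall h v, indcoinv_to_st Gam rho (rmul x (pind h v)) = 0) ->
  forall n, n \in N x -> indcoinv_to_st Gam rho n = 0.
Proof.
move=> gen n /asboolP[m ->].
exact: (@indcoinv_ext _ _ _ _ _ _ (indcoinv_to_st Gam rho \o rmul x) \0).
Qed.

Definition st_tens v (s : steinberg R) : st_coinv Gam rho :=
  coinv_pi Gam (tens_rep (st_rep R) rho) (ptens s v).

Lemma st_tens_is_linear v : linear (st_tens v).
Proof. by move=> a s t; rewrite /st_tens ptensDl ptensZl linearP. Qed.
HB.instance Definition _ v := GRing.isLinear.Build R (steinberg R)
  (st_coinv Gam rho) _ (st_tens v) (st_tens_is_linear v).

Lemma to_st_pind h v : indcoinv_to_st Gam rho (pind h v) =
  st_tens v (st_sym R (gcol h 1) (gcol h 0)).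
Proof. exact: indcoinv_to_stE. Qed.

Lemma relations_to_st n : n \in T -> indcoinv_to_st Gam rho n = 0.
Proof.
move=> /asboolP[m /asboolP[mJ + [mS + ->]] [mL + ->]].
move=> /indcoinv_to_st_rmul J0 /indcoinv_to_st_rmul S0 /indcoinv_to_st_rmul L0.
rewrite !linearD /= {}J0 ?{}S0 ?{}L0 ?addr0 // => h v.
- rewrite rmul_LE !linearD /= !to_st_pind -!(linearD (st_tens v)).
  by rewrite st_matL linear0.
- by rewrite rmul_SE linearD /= !to_st_pind st_matS linearN subrr.
- by rewrite rmul_JE linearB /= !to_st_pind st_matJ subrr.
Qed.

(** The quotient map [q] by the relations satisfies the hypotheses of [manin_potential] for each v,
    so by [coinv_liftE] it kills whatever the induced map kills. *)
Lemma kernel_to_st n : indcoinv_to_st Gam rho n = 0 -> n \in T.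
Proof.
move=> n0; apply: lspan_sub; apply: lpi_eq0.
pose q := lpi (fun w => w \in T); rewrite -/(q n).
have q0 w : w \in T -> q w = 0.
  by move=> wT; rewrite -(linear0 q); apply: lpi_eq; rewrite subr0 mem_lspan.
have qJ h v : q (pind (h * matJ)%g v) = q (pind h v).
  apply/esym/eqP; rewrite -subr_eq0 -linearB -rmul_JE; apply/eqP/q0.
  by apply/mem_submod_suml/mem_submod_suml/asboolP; exists (pind h v).
have qS v h : q (pind (h * matS)%g v) = - q (pind h v).
  apply/eqP; rewrite -addr_eq0 addrC -linearD -rmul_SE; apply/eqP/q0.
  by apply/mem_submod_suml/mem_submod_sumr/asboolP; exists (pind h v).
have qL v h : q (pind h v) + q (pind (h * matL)%g v) +
    q (pind (h * matL * matL)%g v) = 0.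
  rewrite -!(linearD q) -rmul_LE; apply/q0.
  by apply/mem_submod_sumr/asboolP; exists (pind h v).
have /choice[F FP] v := manin_potential (qJ^~ v) (qS v) (qL v).
apply: etrans (esym (coinv_liftE qJ (fun v => proj1 (FP v))
  (fun v => proj2 (FP v)) n)) _.
by rewrite n0 linear0.
Qed.

(** Since [a, b] = [oo, b] - [oo, a], it suffices to reach the symbols [oo, b], which are sums of
    edges along a chain from oo to b. *)
Lemma to_st_surjective c : exists n, c = indcoinv_to_st Gam rho n.
Proof.
pose Im x := exists n, x = indcoinv_to_st Gam rho n.
have ImP a x y : Im x -> Im y -> Im (a *: x + y).
  by move=> [m ->] [n ->]; exists (a *: m + n); rewrite linearP.
have Im0 : Im 0 by exists 0; rewrite linear0.
have Imoo b v : Im (st_tens v (st_sym R ucoloo b)).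
  elim/cusp_ind: b => [|h IH]; first by rewrite st_self linear0.
  rewrite (st_cocycle R _ (umulv h ucol0)) (linearD (st_tens v)).
  rewrite -[X in X + _]scale1r.
  by apply: (ImP) => //; exists (pind h v); rewrite to_st_pind.
have Imst a b v : Im (st_tens v (st_sym R a b)).
  have -> : st_sym R a b = -1 *: st_sym R ucoloo a + st_sym R ucoloo b.
    by rewrite (st_cocycle R ucoloo a b) scaleN1r addKr.
  by rewrite (linearP (st_tens v)); apply: (ImP); apply: Imoo.
elim/lquotP: c; elim/lquotP; elim/freeg_lin_ind => [|a [s v] x IH].
  by rewrite !linear0.
rewrite !linearP /=; apply: (ImP) => //; rewrite -/(ptens s v) -/(st_tens v s).
elim/lquotP: s; elim/freeg_lin_ind => [|b [u w] y IHy].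
  by rewrite !linear0.
by rewrite linearP (linearP (st_tens v)); apply: (ImP) => //; apply: (Imst).
Qed.

Lemma steinberg_presentation : short_exact (incl T) (indcoinv_to_st Gam rho).
Proof.
split=> [||c]; first exact: val_inj.
- move=> b; split=> [/kernel_to_st bT|[[m mT] ->]]; last exact: relations_to_st.
  by exists (Submodule bT).
- exact: to_st_surjective.
Qed.

End Presentation.

Theorem theorem1 (l : nat) (l_prime : prime l) (l_unram : unramified l)
    (R : closedFieldType) (iota : {rmorphism 'F_l -> R})
    (R_closure : algebraic_closure_Fp iota)
    (Gam : {pred GL2 gaussInt}) (Gam_congr : congruence_subgroup Gam)
    (V : lmodType R) (rho : linrep (GL2 (Omod l_prime)) V)
    (V_weight : serre_weight rho) :
  let rhoO := pull_rep (red l_prime) rho in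
  let N (x : {freeg (GL2 gaussInt) / R}) := rmul_img Gam rhoO x in
  short_exact
    (incl (submod_sum
      (submod_sum (N (<< 1%g >> - << matJ >>)) (N (<< 1%g >> + << matS >>)))
      (N (<< 1%g >> + << matL >> + << (matL * matL)%g >>))))
    (indcoinv_to_st Gam rhoO).
Proof. exact: steinberg_presentation. Qed.
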